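(* For $n,m\in\mathbb{N}$ let $kr_2(n,m)$ denote the number of partitions $\lambda_1\le\lambda_2\le\cdots\le\lambda_m$ of $n$ into $m$ parts satisfying: (a) no consecutive parts are allowed (i.e. no two parts are consecutive integers $k,k+1$); (b) odd parts do not repeat; (c) for every contiguous sub-partition $\lambda_i+\lambda_{i+1}+\lambda_{i+2}$, we have $|\lambda_i-\lambda_{i+2}|\ge4$ if $\lambda_{i+1}$ is even and appears more than once; (d') $1$ is not allowed to appear as a part. Then $$\begin{aligned}&\sum_{m,n\ge0}kr_2(n,m)q^nt^m\\&=\sum_{\substack{m_1,m_2,m_3,\\ m,n_{12},i,j\ge0}}\frac{P(m_1,m_2,m_3,m+1;q^2)\,q^{2mn_{12}+2n_{12}^2+i+(2m_1+2m_2+5m_3+n_{12}+i+2j)^2}}{(q^2;q^2)_{n_{12}}(q^6;q^6)_{m_1+m_2+2m_3}(q^2;q^2)_i(q^4;q^4)_j}\,t^{2m_1+2m_2+5m_3+n_{12}+i+2j},\end{aligned}$$ where the $P(m_1,m_2,m_3,m+1;q)$ are the polynomials in $q$ with (evidently) nonnegative coefficients defined in the context. Moreover, the right-hand side is an evidently positive series, i.e. every summand has nonnegative coefficients as a power series in $q$ and $t$.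
   Context: A partition is a finite nondecreasing sequence of positive integers (possibly empty); its weight is the sum of its parts. $|q|<1$ (or: identities of formal power series). $(a;q)_0=1$, $(a;q)_n=(1-a)(1-aq)\cdots(1-aq^{n-1})$. The polynomials $P$. The following notions concern partitions in which each part appears at most twice. Pairs and singletons. Read the parts $\lambda_1\le\lambda_2\le\cdots$ from left to right: at the current part $\lambda_i$, if $\lambda_{i+1}$ exists and $\lambda_{i+1}-\lambda_i\in\{0,1\}$, then $[\lambda_i,\lambda_{i+1}]$ is declared a pair and one continues with $\lambda_{i+2}$; otherwise $\lambda_i$ is declared a singleton and one continues with $\lambda_{i+1}$. So each pair is a pair of repeating parts $[k,k]$ or a pair of consecutive parts $[k,k+1]$. Backward moves on pairs. A backward move on a pair replaces $[k,k+1]$ by $[k-1,k-1]$, or $[k,k]$ by $[k-2,k-1]$ (after which the parts are re-sorted and pairs are determined anew). It is possible only if all parts of the result are positive, each part of the result appears at most twice, and the pair is not moved through another pair, i.e. the smaller part of the moved pair is at least the larger part of the immediately preceding pair (if there is one). Base partitions. A base partition is a partition $\beta$ with each part appearing at most twice such that (i) no backward move is possible on any pair of $\beta$; (ii) the singletons located after the last (largest) pair (all singletons, if there are no pairs) are exactly $k+1,k+3,\dots,k+2n_{12}-1$ for some $n_{12}\ge0$, where the largest pair is $[k,k]$ or $[k,k+1]$, and $k=0$ if there are no pairs. The singletons in (ii) are called moveable; the other singletons, lying between pairs, are called immobile. Blocks. A block of a base partition is a group of five parts of the form $[k-1,k],k,[k+2,k+2]$ (two successive pairs with an immobile singleton $k$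 between them). Definition of $P$. For $m_1,m_2,m_3\in\mathbb{N}$ not all zero and $m\in\mathbb{Z}$, $P(m_1,m_2,m_3,m+1;q)=\sum_\beta q^{w(\beta)}$, the sum over base partitions $\beta$ without moveable singletons having exactly $m_3$ blocks, $m_1$ pairs of repeating parts not contained in blocks, and $m_2$ pairs of consecutive parts not contained in blocks, and whose largest pair is $[m,m]$ or $[m,m+1]$; $w(\beta)$ is the weight. Also $P(0,0,0,1;q)=1$ and $P(0,0,0,m+1;q)=0$ for $m\ne0$. $P(\cdots;q^2)$ means $q$ replaced by $q^2$. *)

(* Defs.v *)
From mathcomp Require Import all_boot all_order all_algebra.
From mathcomp Require Import zify.

Set Implicit Arguments.
Unset Strict Implicit.
Unset Printing Implicit Defensive.

Import Order.TTheory GRing.Theory Num.Theory.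

Definition is_partition (s : seq nat) : bool := sorted leq s && all (leq 1) s.

Definition no_consecutive_parts (s : seq nat) : bool :=
  all (fun k => k.+1 \notin s) s.

Definition odd_parts_distinct (s : seq nat) : bool :=
  all (fun k => odd k ==> (count_mem k s <= 1)) s.

Definition even_repeat_gap (s : seq nat) : bool :=
  all (fun i => (~~ odd (nth 0 s i.+1) && (1 < count_mem (nth 0 s i.+1) s))
                ==> (4 <= `|nth 0 s i - nth 0 s i.+2|))
      (iota 0 (size s - 2)).

Definition kr2_partition (s : seq nat) : bool :=
  [&& is_partition s, no_consecutive_parts s, odd_parts_distinct s,
      even_repeat_gap s & 1 \notin s].

Definition kr2 (n m : nat) : nat :=
  #|[set t : m.-tuple 'I_n.+1 |
      let s := map val t in kr2_partition s && (sumn s == n)]|.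

Inductive group := Pair of nat & nat | Single of nat.

Fixpoint groups (s : seq nat) : seq group :=
  match s with
  | [::] => [::]
  | a :: t =>
      match t with
      | [::] => [:: Single a]
      | b :: u => if (b == a) || (b == a.+1) then Pair a b :: groups u
                  else Single a :: groups t
      end
  end.

Definition parts_of_group (g : group) : seq nat :=
  match g with Pair a b => [:: a; b] | Single a => [:: a] end.

Definition ungroup (gs : seq group) : seq nat :=
  flatten (map parts_of_group gs).

Definition last_pair (gs : seq group) : option (nat * nat) :=
  foldl (fun r g => if g is Pair a b then Some (a, b) else r) None gs.

Definition trailing_singles (gs : seq group) : seq nat :=
  foldl (fun r g => if g is Single a then rcons r a else [::]) [::] gs.

Definition at_most_twice (s : seq nat) : bool :=
  all (fun k => count_mem k s <= 2) s.

(* Truncated subtraction is harmless: a part that would be nonpositive becomes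
   0 and is rejected by the positivity test of [backward_move_possible]. *)
Definition backward_pair (a b : nat) : nat * nat :=
  if a == b then (a - 2, a - 1) else (a - 1, a - 1).

Definition backward_move_possible (gs : seq group) (i : nat) : bool :=
  if nth (Single 0) gs i is Pair a b then
    let: (a', b') := backward_pair a b in
    let s := sort leq (ungroup (set_nth (Single 0) gs i (Pair a' b'))) in
    [&& all (leq 1) s, at_most_twice s &
        if last_pair (take i gs) is Some (_, d) then d <= a' else true]
  else false.

Definition is_base (s : seq nat) : bool :=
  let gs := groups s in
  let k := if last_pair gs is Some (a, _) then a else 0 in
  let ts := trailing_singles gs in
  [&& is_partition s, at_most_twice s,
      all (fun i => ~~ backward_move_possible gs i) (iota 0 (size gs)) &
      ts == [seq k + r.*2.+1 | r <- iota 0 (size ts)]].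

Definition block_at (gs : seq group) (i : nat) : bool :=
  if drop i gs is [:: Pair a b, Single c, Pair d e & _] then
    [&& b == a.+1, c == b, d == c.+2 & e == d]
  else false.

Definition in_block (gs : seq group) (i : nat) : bool :=
  has (fun j => block_at gs j && (i < j + 3)) (iota 0 i.+1).

Definition num_blocks (gs : seq group) : nat :=
  count (block_at gs) (iota 0 (size gs)).

Definition num_free_repeating (gs : seq group) : nat :=
  count (fun i => if nth (Single 0) gs i is Pair a b
                  then (b == a) && ~~ in_block gs i else false)
        (iota 0 (size gs)).

Definition num_free_consecutive (gs : seq group) : nat :=
  count (fun i => if nth (Single 0) gs i is Pair a b
                  then (b == a.+1) && ~~ in_block gs i else false)
        (iota 0 (size gs)).

(* [l] is one more than the smaller part of the largest pair. *)
Definition P_index (m1 m2 m3 : nat) (l : int) (s : seq nat) : bool :=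
  let gs := groups s in
  [&& is_base s, trailing_singles gs == [::],
      num_blocks gs == m3, num_free_repeating gs == m1,
      num_free_consecutive gs == m2 &
      if last_pair gs is Some (a, _) then (a%:Z + 1 == l)%R else false].

Lemma last_pair_trailing gs :
  trailing_singles gs = [::] ->
  if last_pair gs is Some (_, b) then last 0 (ungroup gs) = b else True.
Proof.
rewrite /trailing_singles /last_pair /ungroup.
case/lastP: gs => [//|gs g]; rewrite !foldl_rcons.
case: g => [a b _|a]; last by case: (foldl _ _ _).
by rewrite map_rcons flatten_rcons last_cat.
Qed.

Lemma groups_cons2 a b u :
  groups [:: a, b & u] =
  if (b == a) || (b == a.+1) then Pair a b :: groups u
  else Single a :: groups (b :: u).
Proof. by []. Qed.

Lemma ungroupK s : ungroup (groups s) = s.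
Proof.
have [n] := ubnP (size s); elim: n s => // n IHn [|a [|b u]] // lt_n.
rewrite groups_cons2; case: ifP => _.
  rewrite -[LHS]/[:: a, b & ungroup (groups u)] IHn //.
  by move: lt_n => /=; lia.
by rewrite -[LHS]/(a :: ungroup (groups (b :: u))) IHn.
Qed.

Lemma last_pair_groups s a b : last_pair (groups s) = Some (a, b) -> b <= a.+1.
Proof.
rewrite /last_pair.
have: forall c d : nat, None = Some (c, d) -> d <= c.+1 by [].
move: None; have [n] := ubnP (size s).
elim: n s => // n IHn [|c [|d u]] lt_n r hr.
- by move/hr.
- by move/hr.
rewrite groups_cons2; case: ifP => h.
  rewrite -[foldl _ _ _]/(foldl _ (Some (c, d)) (groups u)).
  by apply: IHn; [move: lt_n => /=; lia | move=> _ _ [<- <-]; lia].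
rewrite -[foldl _ _ _]/(foldl _ r (groups (d :: u))).
exact: IHn.
Qed.

(* The index type of the sum defining [P] omits no partition. *)
Lemma P_index_bound m1 m2 m3 l s : P_index m1 m2 m3 l s ->
  size s <= 2 * `|l| /\ all (fun x => x < `|l|.+1) s.
Proof.
case/and5P=> /and4P[/andP[srt pos] tw _ _] /eqP tr _ _ /andP[_].
have := last_pair_trailing tr; rewrite ungroupK.
have := @last_pair_groups s; case: (last_pair _) => [[a b]|] // hb lastb /eqP def_l.
have {}hb := hb a b erefl.
have le_all : all (fun x => x < `|l|.+1) s.
  apply/allP => x xs; suff: x <= b by lia.
  rewrite -lastb; case/lastP: s xs srt {pos tw tr lastb} => // s z.
  rewrite last_rcons mem_rcons inE => /orP[/eqP-> //|xs].
  rewrite -cats1 (sorted_pairwise leq_trans) pairwise_cat.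
  by case/andP=> /allrelP/(_ x z xs (mem_head _ _)).
split=> //.
have -> : size s = \sum_(x <- undup s) count_mem x s.
  rewrite -sum1_size -big_undup_iterop_count; apply: eq_bigr => x _.
  by rewrite Monoid.iteropE iter_addn_0 mul1n.
have le_u : size (undup s) <= `|l|.
  rewrite -(size_iota 1 `|l|); apply: uniq_leq_size (undup_uniq s) _ => x.
  rewrite mem_undup mem_iota => xs.
  by have := allP le_all x xs; have := allP pos x xs; lia.
apply: (@leq_trans (\sum_(x <- undup s) 2)).
  rewrite big_seq [X in _ <= X]big_seq; apply: leq_sum => x.
  by rewrite mem_undup => /(allP tw).
by rewrite big_const_seq count_predT iter_addn_0 leq_mul2l.
Qed.

Local Open Scope ring_scope.

Definition P (m1 m2 m3 : nat) (l : int) : {poly int} :=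
  if [&& m1 == 0, m2 == 0 & m3 == 0]%N then (if l == 1 then 1 else 0)
  else \sum_(b : (2 * `|l|).-bseq 'I_`|l|.+1
              | P_index m1 m2 m3 l (map val b)) 'X^(sumn (map val b)).

Definition qpoch (a x : {poly int}) (n : nat) : {poly int} :=
  \prod_(k < n) (1 - a * x ^+ k).

Lemma qpoch_coef0 k n : (0 < k)%N -> (qpoch 'X^k 'X^k n)`_0 = 1.
Proof.
move=> k0; rewrite -horner_coef0 horner_prod big1 // => i _.
by rewrite hornerD hornerN hornerM !hornerE expr0n eqn0Ngt k0 mul0r subr0.
Qed.

(* The coefficients of the power series p / d, for d with constant term 1,
   from 1 / d = \sum_k (1 - d)^k. *)
Definition series_quot (p d : {poly int}) (n : nat) : int :=
  (p * \sum_(k < n.+1) (1 - d) ^+ k)`_n.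

Lemma series_quotP (p d : {poly int}) (n : nat) : d`_0 = 1 ->
  \sum_(i < n.+1) d`_i * series_quot p d (n - i) = p`_n.
Proof.
move=> d0; have small (r : {poly int}) k j : (j < k)%N -> (r * (1 - d) ^+ k)`_j = 0.
  have [u ->] : exists u, 1 - d = 'X * u.
    exists (drop_poly 1 (1 - d)); rewrite -{1}[1 - d](poly_take_drop 1) expr1 mulrC.
    suff -> : take_poly 1 (1 - d) = 0 by rewrite add0r.
    by apply/polyP=> [] [|i]; rewrite coef_take_poly coef0 //= coefB coef1 d0 subrr.
  by move=> jk; rewrite exprMn mulrCA coefXnM jk.
have stab c j : (p * \sum_(k < j.+1 + c) (1 - d) ^+ k)`_j = series_quot p d j.
  rewrite big_split_ord /= mulrDr coefD [X in _ + X](_ : _ = 0) ?addr0 //.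
  rewrite mulr_sumr coef_sum big1 // => k _; apply: small; lia.
transitivity ((d * (p * \sum_(k < n.+1) (1 - d) ^+ k))`_n).
  rewrite coefM; apply: eq_bigr => i _; congr (_ * _); rewrite -(stab i).
  by rewrite addSn subnK // leq_ord.
rewrite mulrCA -{1}[d](subKr 1) -opprB mulNr -subrX1 opprB mulrBr mulr1 coefB.
by rewrite small // subr0.
Qed.

(* [S n m] is the coefficient of q^n t^m. *)
Definition qt_series := nat -> nat -> int.

Definition qt_shift (f : nat -> int) (e : nat) : qt_series :=
  fun n m => if m == e then f n else 0.

Definition has_formal_sum (I : eqType) (F : I -> qt_series) (S : qt_series) :=
  forall n m : nat, exists s : seq I,
    [/\ uniq s, forall x, x \notin s -> F x n m = 0
      & \sum_(x <- s) F x n m = S n m].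

Definition kr2_summand (m1 m2 m3 m n12 i j : nat) : qt_series :=
  let N := (2 * m1 + 2 * m2 + 5 * m3 + n12 + i + 2 * j)%N in
  qt_shift
    (series_quot
       ((P m1 m2 m3 (m%:Z + 1) \Po 'X^2)
          * 'X^(2 * m * n12 + 2 * n12 ^ 2 + i + N ^ 2))
       (qpoch 'X^2 'X^2 n12 * qpoch 'X^6 'X^6 (m1 + m2 + 2 * m3)
          * qpoch 'X^2 'X^2 i * qpoch 'X^4 'X^4 j))
    N.

(* Main.v *)
From HB Require Import structures.
Require Import Defs.
From mathcomp Require Import all_boot all_order all_algebra.
From mathcomp Require Import zify ring boolp.
Set Implicit Arguments.
Unset Strict Implicit.
Unset Printing Implicit Defensive.
Import GRing.Theory Num.Theory.

(** Write p = q^2 and read both sides as power series in t over the power series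
in q. On the right, the coefficient of t^N carries the factor q^(N^2); without
it the sums over i and j are the products of 1 / (1 - t q^v) over the odd v and
of 1 / (1 - t^2 q^(2v)) over the even v >= 0 (odd_series, even_series). What
remains is the series F of the base partitions, and the heart of the matter is
that F(t) is the product over v >= 1 of 1 + t p^v + t^2 p^(2v), the generating
function of the partitions in which no part appears three times. Only the
functional equation F(t) = (1 + t p + t^2 p^2) F(t p) is needed (twice_seriesE).

To reach it, a base partition without moveable singletons is seen as a word
whose next group of parts depends only on the last pair: the pair must be
stuck against its predecessor, and the only immobile singletons are those of
the blocks (chain_of_immovable, chains_immobile, P_chains). The words with M
pairs, weighted by the Rogers-Ramanujan series of the moveable singletons, are
thus counted by a series h_M, and a companion k_M for the words that follow a
pair of consecutive parts, both given by a recursion on M (chain_sum). A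
partition read from its smallest part onwards leads instead to a recursion
along t -> t p. The bridge between the two is the pair of identities
  p^(3M) h_M(t) = k_M(t p) + t p h_M(t p^2),
  p^(3M) k_M(t) = h_M(t p^2) + t p^2 h_M(t p^3) + t p k_M(t p^2)
of pair_sums_shift. They imply that h_M / (p^3; p^3)_M satisfies the recursion
of the partitions with exactly M pairs, obtained by removing the first group of
parts. So the forward moves of the pairs are accounted for by algebra, and no
bijection has to be followed. Summing over M gives F.

On the left, a partition is read from its smallest part onwards, remembering
only the smallest value allowed for the next part and the smallest value
allowed for the next repeated part (kr2_admissible). Three classes of
partitions occur, up to a shift of all parts by an even number, and they
satisfy a linear system (adm_shift_system) that has a single solution
(shift_system_uniq), because all parts tend to infinity with the shift.
Multiplying the coefficient of t^N by q^(N^2) turns the functional equations of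
the product of the three series above into the same system
(twisted_shift_system).

Nonnegativity of the summands is clear: P is a sum of monomials and 1 / (q^k;
q^k)_n has nonnegative coefficients. *)

(** * Backward moves on a pair *)

Local Open Scope nat_scope.

Definition group_code (g : group) : nat * nat + nat :=
  match g with Pair a b => inl (a, b) | Single a => inr a end.
Definition group_decode (c : nat * nat + nat) : group :=
  match c with inl (a, b) => Pair a b | inr a => Single a end.
Lemma group_codeK : cancel group_code group_decode.
Proof. by case. Qed.
HB.instance Definition _ := Equality.copy group (can_type group_codeK).

Lemma ungroup_cat gs hs : ungroup (gs ++ hs) = ungroup gs ++ ungroup hs.
Proof. by rewrite /ungroup map_cat flatten_cat. Qed.

Lemma ungroup_pair a e gs : ungroup (Pair a e :: gs) = [:: a, e & ungroup gs].
Proof. by []. Qed.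

Lemma ungroup_single a gs : ungroup (Single a :: gs) = a :: ungroup gs.
Proof. by []. Qed.

Lemma at_most_twiceP s :
  reflect (forall k, count_mem k s <= 2) (at_most_twice s).
Proof.
apply: (iffP allP) => [h k|h k _]; last exact: h.
by case: (boolP (k \in s)) => [/h//|/count_memPn ->].
Qed.

Definition ends_with_pair (gs : seq group) : bool :=
  if last (Pair 0 0) gs is Pair _ _ then true else false.

Lemma trailing_singles_eq0 gs :
  (trailing_singles gs == [::]) = ends_with_pair gs.
Proof.
rewrite /trailing_singles /ends_with_pair; case/lastP: gs => // gs g; rewrite foldl_rcons last_rcons.
by case: g => //= a; case: foldl.
Qed.

(** The two extra zeros act as an initial pair [0, 0]. A move that would
create a nonpositive part creates a 0 under truncated subtraction, and is then
refused because 0 would appear three times. So positivity needs no separate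
treatment, and the first pair behaves like the others. *)
Definition extended_parts (gs : seq group) : seq nat := [:: 0, 0 & ungroup gs].

Definition multiplicity (gs : seq group) (k : nat) : nat :=
  (k == 0).*2 + count_mem k (ungroup gs).

Lemma count_extended_parts gs k :
  count_mem k (extended_parts gs) = multiplicity gs k.
Proof. by rewrite /multiplicity /= [0 == k]eq_sym; case: (k == 0); lia. Qed.

Definition well_formed (gs : seq group) : bool :=
  sorted leq (extended_parts gs) && at_most_twice (extended_parts gs).

Definition last_pair_end (gs : seq group) : nat :=
  if last_pair gs is Some (_, d) then d else 0.

Lemma set_nth_size_cat (T : Type) (x0 : T) s y t z :
  set_nth x0 (s ++ y :: t) (size s) z = s ++ z :: t.
Proof. by elim: s => //= x s ->. Qed.

Lemma sorted_cat_le (s t : seq nat) x y :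
  sorted leq (s ++ t) -> x \in s -> y \in t -> x <= y.
Proof.
rewrite (sorted_pairwise leq_trans) pairwise_cat => /andP[/allrelP h _]; exact: h.
Qed.

(** Only the parts before the moved pair matter: those after it are at least as
large as its smaller part, hence larger than both parts of the result. *)
Lemma backward_move_possibleE pre a e post :
    e = a \/ e = a.+1 -> well_formed (pre ++ Pair a e :: post) ->
  backward_move_possible (pre ++ Pair a e :: post) (size pre) =
  let: (a', e') := backward_pair a e in
  [&& (a' == e') + multiplicity pre a' <= 1,
      (a' == e') + multiplicity pre e' <= 1
    & last_pair_end pre <= a'].
Proof.
move=> ae /andP[srt /at_most_twiceP twice].
have post_ge y : y \in ungroup post -> a <= y.
  move=> y_post; apply: (@sorted_cat_le ([:: 0, 0 & ungroup pre] ++ [:: a; e]) (ungroup post)) => //.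
    by move: srt; rewrite /extended_parts ungroup_cat ungroup_pair -catA.
  by rewrite mem_cat mem_head orbT.
have post0 k : k < a -> count_mem k (ungroup post) = 0.
  by move=> lt_ka; apply/count_memPn/negP => /post_ge; lia.
have {}twice k : ((k == 0)).*2 + count_mem k (ungroup pre) + (a == k) + (e == k)
    + count_mem k (ungroup post) <= 2.
  have := twice k; rewrite count_extended_parts /multiplicity.
  by rewrite ungroup_cat ungroup_pair count_cat /=; lia.
rewrite /backward_move_possible nth_cat ltnn subnn /=.
have lt_a' : (backward_pair a e).2 < a /\ (backward_pair a e).1 <= (backward_pair a e).2.
  rewrite /backward_pair; have a0 : 0 < a by case: (a) (twice 0) => //=; lia.
  by case: ae => ->; case: eqP => /=; lia.
case: (backward_pair a e) lt_a' => a' e' /= [lt_e'a le_a'e'].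
rewrite set_nth_size_cat take_size_cat //.
rewrite !(perm_all _ (permEl (perm_sort _ _))).
rewrite -/(last_pair_end pre) (_ : (if last_pair pre is Some (_, d) then d <= a' else true)
   = (last_pair_end pre <= a')); last by rewrite /last_pair_end; case: last_pair => [[]|].
set S := ungroup (pre ++ Pair a' e' :: post).
have countS k : count_mem k (sort leq S) =
    count_mem k (ungroup pre) + (a' == k) + (e' == k) + count_mem k (ungroup post).
  rewrite (permP (permEl (perm_sort _ _))) /S ungroup_cat ungroup_pair count_cat /=; lia.
rewrite /multiplicity.
case: (boolP (_ <= a')) => _; rewrite ?andbT ?andbF //.
have pos_other x : (x \in ungroup pre) || (x \in ungroup post) -> 0 < x.
  by rewrite -!has_pred1 !has_count; have := twice x; case: x => //=; lia.
apply/andP/andP=> [[/allP pos /at_most_twiceP le2]|[]].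
  have a'0 : 0 < a' by apply: pos; rewrite /S ungroup_cat mem_cat mem_head orbT.
  by have := le2 a'; have := le2 e'; rewrite !countS; lia.
move=> c1 c2; have a'0 : 0 < a' by move: c1; case: (a') => //=; lia.
split.
  apply/allP => x; rewrite /S ungroup_cat ungroup_pair mem_cat !inE.
  by case/or4P=> [||| h]; [| lia | lia |]; move=> *; apply: pos_other; apply/orP; auto.
apply/at_most_twiceP => k; rewrite countS.
have [ka|ka] := eqVneq k a'.
  by rewrite ka post0; [move: c1; lia | lia].
have [ke|ke] := eqVneq k e'.
  by rewrite ke post0; [move: c2; lia | lia].
by have := twice k; lia.
Qed.

(** * Base partitions without moveable singletons as words *)

Lemma multiplicity_cat gs hs k :
  multiplicity (gs ++ hs) k = multiplicity gs k + count_mem k (ungroup hs).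
Proof. by rewrite /multiplicity ungroup_cat count_cat addnA. Qed.

Lemma extended_parts_cat gs hs :
  extended_parts (gs ++ hs) = extended_parts gs ++ ungroup hs.
Proof. by rewrite /extended_parts ungroup_cat. Qed.

Lemma multiplicity_gt0 gs k : (0 < multiplicity gs k) = (k \in extended_parts gs).
Proof. by rewrite -count_extended_parts -has_count has_pred1. Qed.

Lemma well_formed_multiplicity gs k : well_formed gs -> multiplicity gs k <= 2.
Proof. by case/andP=> _ /at_most_twiceP/(_ k); rewrite count_extended_parts. Qed.

Lemma well_formed_prefix gs hs : well_formed (gs ++ hs) -> well_formed gs.
Proof.
move=> wf; apply/andP; split.
  have /andP[] := wf; rewrite extended_parts_cat !(sorted_pairwise leq_trans).
  by rewrite pairwise_cat => /and3P[].
apply/at_most_twiceP => k; rewrite count_extended_parts.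
by have := well_formed_multiplicity k wf; rewrite multiplicity_cat; lia.
Qed.

Lemma well_formed_le gs hs k y :
  well_formed (gs ++ hs) -> 0 < multiplicity gs k -> y \in ungroup hs -> k <= y.
Proof.
case/andP; rewrite extended_parts_cat multiplicity_gt0 => srt _ in_k in_y.
exact: sorted_cat_le srt in_k in_y.
Qed.

Lemma well_formed_cat gs hs :
    well_formed gs -> sorted leq (ungroup hs) ->
    (forall k y, y \in ungroup hs -> y < k -> multiplicity gs k = 0) ->
    (forall k, multiplicity gs k + count_mem k (ungroup hs) <= 2) ->
  well_formed (gs ++ hs).
Proof.
case/andP=> srt _ srt_hs below twice; apply/andP; split; last first.
  apply/at_most_twiceP => k.
  by rewrite count_extended_parts multiplicity_cat.
move: srt srt_hs; rewrite extended_parts_cat !(sorted_pairwise leq_trans) pairwise_cat.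
move=> -> ->; rewrite !andbT; apply/allrelP => k y; rewrite -multiplicity_gt0 => k_gs y_hs.
by rewrite leqNgt; apply/negP => /(below _ _ y_hs); lia.
Qed.

(** The groups read so far end with the pair [x, x + b]; both the first pair and
the virtual pair [0, 0] of the empty word are covered. *)
Definition ends_at (gs : seq group) (b : bool) (x : nat) : Prop :=
  [/\ forall k, x + b < k -> multiplicity gs k = 0,
      multiplicity gs (x + b) = 2 - b & last_pair_end gs = x + b].

Lemma ends_at_nil : ends_at [::] false 0.
Proof. by split=> // -[]. Qed.

Lemma ends_at_pair gs (b : bool) a :
  well_formed (gs ++ [:: Pair a (a + b)]) -> ends_at (gs ++ [:: Pair a (a + b)]) b a.
Proof.
move=> wf; split.
- move=> k lt_k; apply/eqP; rewrite multiplicity_cat addn_eq0 /=.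
  rewrite (_ : (a == k) = false) 1?(_ : (a + b == k) = false); [|lia..].
  rewrite addn0 andbT -leqn0 leqNgt; apply/negP => gt0.
  by have := well_formed_le wf gt0 (mem_head _ _); lia.
- have := well_formed_multiplicity (a + b) wf; rewrite multiplicity_cat /= eqxx.
  case: b wf => wf; last by rewrite !addn0 ?eqxx; lia.
  rewrite (_ : (a == _) = false); last by lia.
  case: (posnP (multiplicity gs (a + true))) => [-> //|gt0 _].
  by have := well_formed_le wf gt0 (mem_head _ _); lia.
by rewrite /last_pair_end /last_pair foldl_cat.
Qed.

(** The pairs [a, e] that are stuck when they come right after [x, x + b]. *)
Definition pair_follows (b : bool) (x a e : nat) : bool :=
  if b then [|| (a == x.+2) && (e == x.+2), (a == x.+1) && (e == x.+2)
              | (a == x.+2) && (e == x.+3)]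
  else [|| (a == x.+1) && (e == x.+1), (a == x.+2) && (e == x.+2)
              | (a == x.+1) && (e == x.+2)].

Lemma backward_move_possible_pair pre (b : bool) x a e post :
    ends_at pre b x -> e = a \/ e = a.+1 -> well_formed (pre ++ Pair a e :: post) ->
  backward_move_possible (pre ++ Pair a e :: post) (size pre) =
  ~~ pair_follows b x a e.
Proof.
move=> [above top pair_end] ae wf; rewrite backward_move_possibleE // pair_end.
have x_le_a : x + b <= a.
  by apply: (well_formed_le wf); [rewrite top; case: (b) | apply: mem_head].
have twice := well_formed_multiplicity _ wf.
have {twice}: x + b = a -> b /\ e = a.+1.
  move=> eq_a; have := twice a; rewrite multiplicity_cat -eq_a top /= eq_a eqxx.
  by case: ae => ->; rewrite ?eqxx; case: (b) => //=; lia.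
have mult k : x + b <= k -> multiplicity pre k = if k == x + b then 2 - b else 0.
  by case: eqP => [->//|ne le_k]; apply: above; lia.
rewrite /backward_pair /pair_follows.
case: ae => ->.
  rewrite eqxx => ne_a; have {}x_le_a : x + b < a.
    by rewrite ltn_neqAle x_le_a andbT; apply/eqP => /ne_a; lia.
  case: (leqP (x + b) (a - 2)) => le_d; last first.
    by rewrite !andbF; move: le_d x_le_a; case: (b); lia.
  rewrite !mult ?andbT; [|lia..].
  by move: le_d x_le_a; case: (a - 2 =P x + _); case: (a - 1 =P x + _); case: (b); lia.
rewrite (_ : a == a.+1 = false) ?eqxx; last by lia.
move=> eq_a; case: (leqP (x + b) (a - 1)) => le_d; last first.
  have [|b1 _] := eq_a; first by lia.
  by rewrite !andbF; move: le_d x_le_a; rewrite b1; lia.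
rewrite !mult ?andbT; [|lia..].
by move: le_d x_le_a; case: (a - 1 =P x + _); case: (b) eq_a; lia.
Qed.

(** What may follow the pair [x, x + b], with the new value of (b, x). The last
case, possible only after a pair of consecutive parts, completes a block. *)
Definition next_groups (b : bool) (x : nat) : seq (seq group * (bool * nat)) :=
  if b then [:: ([:: Pair x.+2 x.+2], (false, x.+2));
                ([:: Pair x.+1 x.+2], (true, x.+1));
                ([:: Pair x.+2 x.+3], (true, x.+2));
                ([:: Single x.+1; Pair x.+3 x.+3], (false, x.+3))]
  else [:: ([:: Pair x.+1 x.+1], (false, x.+1));
           ([:: Pair x.+2 x.+2], (false, x.+2));
           ([:: Pair x.+1 x.+2], (true, x.+1))].

Fixpoint chains (M : nat) (b : bool) (x : nat) : seq (seq group) :=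
  if M is M'.+1 then
    [seq e.1 ++ gs | e <- next_groups b x, gs <- chains M' e.2.1 e.2.2]
  else [:: [::]].

Lemma groups_single c d u :
    c <= d -> groups [:: c, d & u] = Single c :: groups (d :: u) ->
  c.+2 <= d.
Proof. by rewrite groups_cons2; case: ifP => // ne le_cd _; lia. Qed.

Lemma last_pair_end_single gs c : last_pair_end (gs ++ [:: Single c]) = last_pair_end gs.
Proof. by rewrite /last_pair_end /last_pair foldl_cat. Qed.

Lemma well_formed_single_le pre c d s :
  well_formed (pre ++ Single c :: groups (d :: s)) -> c <= d.
Proof.
rewrite -cat1s catA => wf; apply: (well_formed_le wf).
  by rewrite multiplicity_cat /= eqxx; lia.
by rewrite ungroupK mem_head.
Qed.

(** A singleton c above all earlier parts leaves room for the next pair to move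
down, whatever singletons come in between. So an immobile singleton can only
be equal to the larger part of the pair before it. *)
Lemma movable_after_single n s pre c :
    size s < n -> groups (c :: s) = Single c :: groups s ->
    (forall k, c <= k -> multiplicity pre k = 0) -> last_pair_end pre <= c ->
    well_formed (pre ++ Single c :: groups s) ->
    ends_with_pair (Single c :: groups s) ->
  exists i, backward_move_possible (pre ++ Single c :: groups s) i.
Proof.
elim: n s pre c => // n IHn [|d [|e u]] // pre c lt_n def_c above pair_end wf last_p.
have le_cd := groups_single (well_formed_single_le wf) def_c.
have mult1 k : multiplicity (pre ++ [:: Single c]) k = multiplicity pre k + (c == k).
  by rewrite multiplicity_cat /= addn0.
move: wf last_p; rewrite groups_cons2; case: ifP => de wf last_p; last first.
  have [||||||i] := IHn (e :: u) (pre ++ [:: Single c]) d.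
  - by move: lt_n => /=; lia.
  - by rewrite groups_cons2 de.
  - by move=> k le_dk; rewrite mult1 above; lia.
  - by rewrite last_pair_end_single; lia.
  - by rewrite -catA.
  - exact: last_p.
  by rewrite -catA; exists i.
exists (size (pre ++ [:: Single c])); rewrite -cat1s catA backward_move_possibleE.
- rewrite last_pair_end_single /backward_pair.
  have {}de : e = d \/ e = d.+1 by move: de; lia.
  by case: eqP => de'; rewrite !mult1 !above; lia.
- by move: de; lia.
by rewrite -catA.
Qed.

(** The parts are read group by group. A pair that cannot move is one of those
allowed by pair_follows; a singleton must equal the larger part of the previous
pair, and then the next pair is forced to complete a block. *)
Lemma chain_of_immovable n s pre (b : bool) x :
    size s < n -> ends_at pre b x -> well_formed (pre ++ groups s) ->
    (forall i, ~~ backward_move_possible (pre ++ groups s) i) ->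
    ends_with_pair (groups s) ->
  exists M, groups s \in chains M b x.
Proof.
elim: n s pre b x => // n IHn [|a [|e u]] // pre b x lt_n end_pre wf immobile last_p.
  by exists 0; apply: mem_head.
have step (p : seq group) b' x' v : p ++ groups v = groups [:: a, e & u] ->
    (p, (b', x')) \in next_groups b x -> size v < n ->
    ends_at (pre ++ p) b' x' -> ends_with_pair (groups v) ->
    exists M, groups [:: a, e & u] \in chains M b x.
  move=> def_s in_p lt_v end_p last_v; have [M in_v] : exists M, groups v \in chains M b' x'.
    apply: (IHn v (pre ++ p)) => //; first by rewrite -catA def_s.
    by move=> i; rewrite -catA def_s.
  exists M.+1; apply/allpairsPdep; exists (p, (b', x')), (groups v).
  by rewrite -def_s.
have ends_v v p g : ends_with_pair (p ++ Pair (g.1) (g.2) :: v) -> ends_with_pair v.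
  by rewrite /ends_with_pair last_cat /=; case: v.
move: wf immobile last_p step; rewrite groups_cons2; case: ifP => ae wf immobile last_p step.
  have {}ae : e = a \/ e = a.+1 by move: ae; lia.
  have := immobile (size pre); rewrite (backward_move_possible_pair end_pre) // negbK.
  have [b' def_e] : exists b' : bool, e = a + b'.
    by case: ae => ->; [exists false; rewrite addn0 | exists true; rewrite addn1].
  have end_p : ends_at (pre ++ [:: Pair a e]) b' a.
    rewrite def_e; apply: ends_at_pair; rewrite -def_e.
    by apply: (@well_formed_prefix _ (groups u)); rewrite -catA.
  move=> follows; apply: (step [:: Pair a e] b' a u) => //.
  - move: follows; rewrite /pair_follows /next_groups def_e.
    by case: (b) => /or3P[] /andP[/eqP -> /eqP]; case: (b') => // e2; try lia;
      rewrite ?addn0 ?addn1 !inE eqxx ?orbT.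
  - by move: lt_n => /=; lia.
  - exact: (ends_v _ [::] (a, e)).
case: end_pre => above top pair_end.
have le_xa : x + b <= a.
  by apply: (well_formed_le wf); [rewrite top; case: (b) | apply: mem_head].
have lt_xa : x + b = a -> b.
  move=> eq_a; have := well_formed_multiplicity a wf.
  by rewrite multiplicity_cat -{1}eq_a top /= eqxx; case: (b) => //=; lia.
have def_a : groups [:: a, e & u] = Single a :: groups (e :: u).
  by rewrite groups_cons2 ae.
have ltae := groups_single (well_formed_single_le wf) def_a.
have no_escape (P : Prop) : (exists i, backward_move_possible
    (pre ++ Single a :: groups (e :: u)) i) -> P.
  by case=> i; rewrite (negPf (immobile i)).
(* A singleton above the last pair contradicts immobility. *)
have [eq_a|ne_a] := eqVneq (x + b) a; last first.
  apply: no_escape; apply: (@movable_after_single n) => //; last by rewrite pair_end.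
  by move=> k le_ak; apply: above; lia.
have b1 : b = true := lt_xa eq_a; subst b; have {eq_a} def_x : a = x.+1 by lia.
subst a; move: lt_n wf immobile last_p step no_escape.
have mult1 k : multiplicity (pre ++ [:: Single x.+1]) k = multiplicity pre k + (x.+1 == k).
  by rewrite multiplicity_cat /= addn0.
case: u ae def_a => [|f v] // ae def_a lt_n.
rewrite (groups_cons2 e f v); case: ifP => ef wf immobile last_p step no_escape; last first.
  apply: no_escape; rewrite -cat1s catA; apply: (@movable_after_single n) => //.
  - by move: lt_n => /=; lia.
  - by rewrite groups_cons2 ef.
  - by move=> k le_ek; rewrite mult1 above; lia.
  - by rewrite last_pair_end_single pair_end; lia.
  by rewrite -catA.
have {}ef : f = e \/ f = e.+1 by move: ef; lia.
have := immobile (size (pre ++ [:: Single x.+1])).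
(* The singleton x + 1 meets a pair [e, f]: only [x + 3, x + 3] is stuck, as
   x + 1 would then appear three times. *)
have wf' : well_formed ((pre ++ [:: Single x.+1]) ++ Pair e f :: groups v) by rewrite -catA.
rewrite -cat1s catA backward_move_possibleE // last_pair_end_single pair_end.
rewrite /backward_pair => immobile2.
have [def_e def_f] : e = x.+3 /\ f = x.+3.
  have top' : multiplicity pre x.+1 = 1 by rewrite -addn1; exact: top.
  have above' k : x.+1 < k -> multiplicity pre k = 0 by move=> lt_k; apply: above; lia.
  have e1 : multiplicity pre (e - 1) = 0 by apply: above'; lia.
  case: ef immobile2 => def_f; case: eqP; try lia; rewrite !mult1 e1 => _.
    have [eq_e|ne] := eqVneq e x.+3; first by lia.
    by rewrite above'; lia.
  by lia.
subst e f; apply: (step [:: Single x.+1; Pair x.+3 x.+3] false x.+3 v) => //.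
- by rewrite !inE eqxx ?orbT.
- by move: lt_n => /=; lia.
- have := @ends_at_pair (pre ++ [:: Single x.+1]) false x.+3.
  rewrite addn0 -catA; apply; apply: (@well_formed_prefix _ (groups v)).
  by rewrite -catA.
exact: (ends_v _ [:: Single x.+1] (x.+3, x.+3)).
Qed.

Lemma next_groupsP b x p b' x' : (p, (b', x')) \in next_groups b x ->
  (p = [:: Pair x' (x' + b')] /\ pair_follows b x x' (x' + b')) \/
  [/\ b = true, p = [:: Single x.+1; Pair x.+3 x.+3], b' = false & x' = x.+3].
Proof.
rewrite /next_groups /pair_follows; case: b; rewrite !inE !xpair_eqE.
  case/or4P=> /and3P[/eqP -> /eqP -> /eqP ->]; [left|left|left|by right];
  by rewrite ?addn0 ?addn1 !eqxx ?orbT.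
by case/or3P=> /and3P[/eqP -> /eqP -> /eqP ->]; left;
  rewrite ?addn0 ?addn1 !eqxx ?orbT.
Qed.

Lemma chains_immobile M (b : bool) x gs pre :
    gs \in chains M b x -> ends_at pre b x -> well_formed pre ->
  well_formed (pre ++ gs) /\
  (forall i, size pre <= i -> ~~ backward_move_possible (pre ++ gs) i).
Proof.
elim: M b x gs pre => [|M IHM] b x gs pre.
  rewrite inE => /eqP -> _ wf; rewrite cats0; split=> // i le_i.
  by rewrite /backward_move_possible nth_default.
case/allpairsPdep=> -[p [b' x']] [gs' [in_p in_gs' ->]] /= end_pre wf.
have [above top pair_end] := end_pre.
case: (next_groupsP in_p) => [[def_p follows]|[def_b def_p def_b' def_x']]; subst p.
  have lt_x' : x + b <= x' /\ (x' = x + b -> b && b').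
    by move: follows; rewrite /pair_follows; case: (b); case: (b'); lia.
  have wf_p : well_formed (pre ++ [:: Pair x' (x' + b')]).
    apply: well_formed_cat => //=; first by rewrite leq_addr.
      move=> k y; rewrite !inE => xy lt_y; apply: above.
      by case/orP: xy => /eqP ?; lia.
    move=> k; rewrite addn0; case: (ltngtP k (x + b)) => lt_k.
    - rewrite (_ : (x' == k) = false) 1?(_ : (x' + b' == k) = false); [|lia..].
      by rewrite addn0 well_formed_multiplicity.
    - by rewrite above //; case: (x' == k); case: (x' + b' == k).
    rewrite lt_k top; case: eqP => [/lt_x'.2/andP[-> ->]|_] //.
      by rewrite (_ : (_ == _) = false); lia.
    rewrite (_ : (_ == _) = false); lia.
  have [wf_all immobile] := IHM _ _ _ _ in_gs' (ends_at_pair wf_p) wf_p.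
  rewrite -catA in wf_all immobile; split=> // i; rewrite leq_eqVlt => /orP[/eqP <-|lt_i].
    rewrite (backward_move_possible_pair end_pre) ?follows //.
    by case: (b'); rewrite ?addn0 ?addn1; auto.
  by apply: immobile; rewrite size_cat addn1.
subst b b' x'; rewrite addn1 in above top pair_end.
have wf_p : well_formed (pre ++ [:: Single x.+1; Pair x.+3 x.+3]).
  apply: well_formed_cat => //=; first by rewrite leqnn !andbT; lia.
    by move=> k y; rewrite !inE => xy lt_y; apply: above; case/or3P: xy => /eqP ?; lia.
  move=> k; case: (ltngtP k x.+1) => lt_k.
  - by have := well_formed_multiplicity k wf; lia.
  - by rewrite above //; case: (x.+3 == k).
  by rewrite lt_k top; lia.
have end_p : ends_at (pre ++ [:: Single x.+1; Pair x.+3 x.+3]) false x.+3.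
  have := @ends_at_pair (pre ++ [:: Single x.+1]) false x.+3.
  by rewrite addn0 -catA; apply.
have [wf_all immobile] := IHM _ _ _ _ in_gs' end_p wf_p.
rewrite -catA in wf_all immobile; split=> // i.
rewrite leq_eqVlt => /orP[/eqP <-|].
  by rewrite /backward_move_possible nth_cat ltnn subnn.
rewrite leq_eqVlt => /orP[/eqP <-|lt_i]; last first.
  by apply: immobile; rewrite size_cat addn2.
rewrite /= -(addn1 (size pre)) -[1]/(size [:: Single x.+1]) -size_cat -cat1s catA.
rewrite backward_move_possibleE -?catA //; last by left.
rewrite /backward_pair eqxx !multiplicity_cat /=.
rewrite (_ : x.+3 - 2 = x.+1) ?top ?eqxx; lia.
Qed.

Lemma groups_chain M b x gs : gs \in chains M b x -> groups (ungroup gs) = gs.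
Proof.
elim: M b x gs => [|M IHM] b x gs; first by rewrite inE => /eqP ->.
case/allpairsPdep=> -[p [b' x']] [gs' [in_p in_gs' ->]] /=.
have IH := IHM _ _ _ in_gs'.
case: (next_groupsP in_p) => [[-> _]|[_ -> _ _]]; rewrite !cat_cons cat0s.
  rewrite ungroup_pair groups_cons2 IH.
  by case: (b'); rewrite ?addn0 ?addn1 eqxx ?orbT.
rewrite ungroup_single ungroup_pair !groups_cons2 eqxx IH ifF //; lia.
Qed.

Lemma chains_end_with_pair M b x gs : gs \in chains M b x -> ends_with_pair gs.
Proof.
elim: M b x gs => [|M IHM] b x gs; first by rewrite inE => /eqP ->.
case/allpairsPdep=> -[p [b' x']] [gs' [in_p in_gs' ->]] /=.
have := IHM _ _ _ in_gs'; rewrite /ends_with_pair last_cat.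
by case: (next_groupsP in_p) => [[-> _]|[_ -> _ _]]; case: gs' {in_gs'}.
Qed.

(** * Numbers of blocks, pairs and parts of a word *)

(** Common form of the numbers of repeating and of consecutive pairs outside
blocks. *)
Definition num_free (T : nat -> nat -> bool) (gs : seq group) : nat :=
  count (fun i => if nth (Single 0) gs i is Pair a b
                  then T a b && ~~ in_block gs i else false)
        (iota 0 (size gs)).

Lemma count_iota_cons (p : pred nat) n :
  count p (iota 0 n.+1) = p 0 + count (fun i => p i.+1) (iota 0 n).
Proof. by rewrite /= -[iota 1 n]/(iota (1 + 0) n) iotaDl count_map. Qed.

Lemma in_block_cons g gs i :
  in_block (g :: gs) i.+1 = block_at (g :: gs) 0 && (i < 2) || in_block gs i.
Proof.
rewrite /in_block -[iota 0 i.+2]/(0 :: iota (1 + 0) i.+1) iotaDl.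
by rewrite [has _ (_ :: _)]/= has_map.
Qed.

Lemma num_blocks_cons g gs :
  num_blocks (g :: gs) = block_at (g :: gs) 0 + num_blocks gs.
Proof. by rewrite /num_blocks [size _]/= count_iota_cons. Qed.

Lemma num_free_cons T g gs : ~~ block_at (g :: gs) 0 ->
  num_free T (g :: gs) = (if g is Pair a e then T a e : nat else 0) + num_free T gs.
Proof.
move=> /negPf nb; rewrite /num_free [size _]/= count_iota_cons; congr (_ + _).
  by rewrite /in_block [has _ _]/= nb /=; case: g {nb} => //= a e; rewrite andbT.
by apply: eq_count => i; rewrite /= in_block_cons nb.
Qed.

Lemma num_free_block T a gs :
  num_free T [:: Pair a a.+1, Single a.+1, Pair a.+3 a.+3 & gs] = num_free T gs.
Proof.
have blk : block_at [:: Pair a a.+1, Single a.+1, Pair a.+3 a.+3 & gs] 0.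
  by rewrite /block_at /= !eqxx.
have nblk1 : block_at [:: Single a.+1, Pair a.+3 a.+3 & gs] 0 = false by [].
have nblk2 : block_at (Pair a.+3 a.+3 :: gs) 0 = false.
  rewrite /block_at /= (_ : a.+3 == a.+4 = false); last by lia.
  by case: gs {blk nblk1} => // -[] // ? [|[]].
rewrite /num_free [size _]/= !count_iota_cons.
rewrite 2!in_block_cons blk /=.
rewrite (_ : in_block _ 0 = true) ?andbF; last by rewrite /in_block [has _ _]/= blk.
rewrite !add0n; apply: eq_count => i.
by rewrite !in_block_cons nblk1 nblk2 blk.
Qed.

(** The state [x, x + b] is included as a first pair because a block starts with
the pair that precedes the singleton. *)
Lemma chain_stats M (b : bool) x gs (full := Pair x (x + b) :: gs) :
    gs \in chains M b x ->
  num_free_repeating full + num_free_consecutive full + 2 * num_blocks full = M.+1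
  /\ 2 * num_free_repeating full + 2 * num_free_consecutive full
     + 5 * num_blocks full = (size (ungroup gs)).+2.
Proof.
rewrite /full {full} -![num_free_repeating _]/(num_free (fun a e => e == a) _).
rewrite -![num_free_consecutive _]/(num_free (fun a e => e == a.+1) _).
elim: M b x gs => [|M IHM] b x gs.
  rewrite inE => /eqP ->; rewrite num_blocks_cons !num_free_cons //.
  by case: b; rewrite ?addn0 ?addn1 eqxx /num_free /num_blocks /=; lia.
case/allpairsPdep=> -[p [b' x']] [gs' [in_p in_gs' ->]] /=.
have IH := IHM b' x' gs' in_gs'.
case: (next_groupsP in_p) IH => [[-> _]|[-> -> -> ->]] IH; rewrite !cat_cons cat0s.
  rewrite (num_blocks_cons (Pair x _)) !(@num_free_cons _ (Pair x _)) //.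
  rewrite (_ : block_at (Pair x _ :: _) 0 = false) // ungroup_pair.
  by move: IH; case: (b); rewrite ?addn0 ?addn1 [size (_ :: _)]/=; cbv beta; lia.
rewrite addn1 !num_free_block !num_blocks_cons.
move: IH; rewrite addn0 num_blocks_cons.
have nb : block_at (Pair x.+3 x.+3 :: gs') 0 = false.
  rewrite /block_at /= (_ : x.+3 == x.+4 = false); last by lia.
  by case: (gs') => // -[] // ? [|[]].
rewrite !num_free_cons ?nb // eqxx (_ : x.+3 == x.+4 = false); last by lia.
rewrite (_ : block_at [:: Pair x x.+1, _ & _] 0 = true); last first.
  by rewrite /block_at /= !eqxx.
rewrite (_ : block_at [:: Single _, _ & _] 0 = false) // ungroup_single ungroup_pair.
by rewrite [size (x.+1 :: _)]/=; lia.
Qed.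

Lemma start_chain_stats M gs : gs \in chains M false 0 ->
  num_free_repeating gs + num_free_consecutive gs + 2 * num_blocks gs = M
  /\ 2 * num_free_repeating gs + 2 * num_free_consecutive gs
     + 5 * num_blocks gs = size (ungroup gs).
Proof.
move/chain_stats; rewrite addn0 num_blocks_cons.
have nb : block_at (Pair 0 0 :: gs) 0 = false by rewrite /block_at; case: gs => // -[] // ? [|[]].
rewrite -![num_free_repeating _]/(num_free (fun a e => e == a) _).
rewrite -![num_free_consecutive _]/(num_free (fun a e => e == a.+1) _).
by rewrite !num_free_cons ?nb //=; lia.
Qed.

Definition last_pair_start (x : nat) (gs : seq group) : nat :=
  foldl (fun r g => if g is Pair a _ then a else r) x gs.

Lemma last_pair_startE x gs :
  last_pair_start x gs = if last_pair gs is Some (a, _) then a else x.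
Proof.
rewrite /last_pair_start /last_pair; elim/last_ind: gs => // gs g.
by rewrite !foldl_rcons => ->; case: g.
Qed.

Lemma last_pair_start_next b x p b' x' gs : (p, (b', x')) \in next_groups b x ->
  last_pair_start x (p ++ gs) = last_pair_start x' gs.
Proof.
rewrite /last_pair_start foldl_cat => /next_groupsP.
by case=> [[-> _]|[_ -> _ ->]].
Qed.

(** Ensures that, for fixed m1, m2, m3, only finitely many m contribute. *)
Lemma last_pair_start_le M b x gs :
  gs \in chains M b x -> last_pair_start x gs <= x + 3 * M.
Proof.
elim: M b x gs => [|M IHM] b x gs; first by rewrite inE => /eqP ->; rewrite addn0.
case/allpairsPdep=> -[p [b' x']] [gs' [in_p in_gs' ->]] /=.
rewrite (last_pair_start_next _ in_p); apply: leq_trans (IHM _ _ _ in_gs') _.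
have le_x' : x' <= x + 3.
  case: (next_groupsP in_p) => [[_]|[_ _ _ ->]]; last by rewrite addn3.
  by rewrite /pair_follows; case: (b); case: (b'); lia.
by rewrite /=; lia.
Qed.

Lemma chains_uniq M b x : uniq (chains M b x).
Proof.
elim: M b x => // M IHM b x; apply: allpairs_uniq_dep => [|[p [b' x']] _|].
- by apply: (@map_uniq _ _ snd); case: b; rewrite /= !inE !xpair_eqE /=; lia.
- exact: IHM.
move=> [[p [b1 x1]] gs1] [[q [b2 x2]] gs2] /= /allpairsPdep[e1 [g1 [in1 _ eq1]]].
have {eq1} /= eq1 := congr1 tag eq1; rewrite -{e1}eq1 in in1.
case/allpairsPdep=> [e2 [g2 [in2 _ eq2]]].
have {eq2} /= eq2 := congr1 tag eq2; rewrite -{e2}eq2 in in2.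
case: (next_groupsP in1) => [[-> _]|[_ -> -> ->]];
  case: (next_groupsP in2) => [[-> _]|[_ -> -> ->]] //=; clear in1 in2.
  case=> -> /addnI eq_b ->; suff -> : b1 = b2 by [].
  by case: b1 b2 eq_b => -[].
by case=> ->.
Qed.

(** * The polynomials P as sums over words *)

Definition chain_index (m1 m2 m3 : nat) (l : int) (gs : seq group) : bool :=
  [&& num_blocks gs == m3, num_free_repeating gs == m1,
      num_free_consecutive gs == m2 & ((last_pair_start 0 gs)%:Z + 1 == l)%R].

Lemma well_formed_groups s :
  well_formed (groups s) = is_partition s && at_most_twice s.
Proof.
rewrite /well_formed /extended_parts ungroupK /is_partition.
apply/andP/andP=> [[srt /at_most_twiceP twice]|[/andP[srt /allP pos] /at_most_twiceP twice]].
  have cnt k : count_mem k s <= 2.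
    by have := twice k => /=; case: (0 == k); lia.
  split; last exact/at_most_twiceP.
  move: srt => /= /path_sorted -> /=; apply/allP => -[|x] //.
  by rewrite -has_pred1 has_count; have := twice 0 => /=; lia.
have s0 : 0 \notin s by apply/negP => /pos.
split.
  rewrite /= (path_sortedE leq_trans) srt andbT.
  by apply/allP.
apply/at_most_twiceP => -[|k] /=; last exact: twice.
by rewrite (count_memPn s0).
Qed.

Lemma is_base_chain s :
    trailing_singles (groups s) == [::] ->
  is_base s <-> exists M, groups s \in chains M false 0.
Proof.
move=> no_trail; rewrite /is_base andbA -well_formed_groups (eqP no_trail) eqxx andbT.
split=> [/andP[wf /allP immobile]|[M in_s]].
  apply: (@chain_of_immovable (size s).+1 s [::]) => //; last first.
  - by rewrite -trailing_singles_eq0.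
  - move=> i; case: (ltnP i (size (groups s))) => lt_i.
      by apply: immobile; rewrite mem_iota.
    by rewrite /backward_move_possible nth_default.
  exact: ends_at_nil.
have [wf immobile] := @chains_immobile M false 0 (groups s) [::] in_s ends_at_nil isT.
by rewrite wf; apply/allP => i _; apply: immobile.
Qed.

(** The word determines m1 + m2 + 2 m3 as its number of pairs, which is what makes
the denominator (q^6; q^6) of the sum depend on the word only. *)
Lemma P_index_chain m1 m2 m3 l s : ~~ [&& m1 == 0, m2 == 0 & m3 == 0] ->
  P_index m1 m2 m3 l s =
  (groups s \in chains (m1 + m2 + 2 * m3) false 0) && chain_index m1 m2 m3 l (groups s).
Proof.
move=> nz; rewrite /P_index /chain_index last_pair_startE.
apply/and5P/andP=> [[base trail nb nr /andP[nc lp]]|[in_s /and4P[nb nr nc lp]]].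
  have /(is_base_chain trail)[M in_s] := base.
  have [def_M _] := start_chain_stats in_s.
  rewrite -(eqP nb) -(eqP nr) -(eqP nc) def_M in_s !eqxx; split=> //.
  by move: lp; case: last_pair => // -[].
have trail : trailing_singles (groups s) == [::].
  by rewrite trailing_singles_eq0 (chains_end_with_pair in_s).
split=> //; first by apply/(is_base_chain trail); exists (m1 + m2 + 2 * m3).
rewrite nc; move: (chains_end_with_pair in_s) lp.
have: groups s != [::].
  by apply: contraNneq nz => gs0; move: nb nr nc; rewrite gs0 /= eq_sym => -> ; rewrite eq_sym => ->; rewrite eq_sym => ->.
rewrite /last_pair /ends_with_pair; case/lastP: (groups s) => // gs g _.
by rewrite last_rcons foldl_rcons; case: g.
Qed.

Lemma P_chains m1 m2 m3 l : (P m1 m2 m3 l =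
  \sum_(gs <- chains (m1 + m2 + 2 * m3) false 0 | chain_index m1 m2 m3 l gs)
    'X^(sumn (ungroup gs)))%R.
Proof.
rewrite /P; case: ifPn => [/and3P[/eqP -> /eqP -> /eqP ->]|nz].
  by rewrite big_cons big_nil /chain_index /= add0r eq_sym; case: ifP; rewrite ?addr0.
set T := (2 * `|l|).-bseq _.
pose F s : {poly int} := ('X^(sumn s))%R.
pose vals (b : T) := map val b.
transitivity (\sum_(s <- [seq vals b | b <- index_enum T] | P_index m1 m2 m3 l s) F s)%R.
  by rewrite big_map.
transitivity (\sum_(s <- [seq ungroup gs | gs <- chains (m1 + m2 + 2 * m3) false 0
                                        & chain_index m1 m2 m3 l gs]) F s)%R; last first.
  by rewrite big_map big_filter.
rewrite -big_filter; apply/perm_big/uniq_perm.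
- rewrite filter_uniq // map_inj_uniq ?index_enum_uniq // => b c.
  by move/(inj_map val_inj)/val_inj.
- rewrite map_inj_in_uniq ?filter_uniq ?chains_uniq // => gs hs.
  rewrite !mem_filter => /andP[_ in_gs] /andP[_ in_hs] eq_gh.
  by rewrite -(groups_chain in_gs) eq_gh (groups_chain in_hs).
move=> s; rewrite mem_filter; apply/andP/mapP=> [[idx _]|[gs]].
  exists (groups s); last by rewrite ungroupK.
  by move: idx; rewrite P_index_chain // mem_filter andbC.
rewrite mem_filter andbC => /andP[in_gs idx] def_s.
have idx_s : P_index m1 m2 m3 l s.
  by rewrite P_index_chain // def_s (groups_chain in_gs) in_gs.
split=> //; have [le_s /allP lt_s] := P_index_bound idx_s.
have size_b : size [seq inord x : 'I_`|l|.+1 | x <- s] <= 2 * `|l| by rewrite size_map.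
apply/mapP; exists (Bseq size_b); first exact: mem_index_enum.
rewrite /vals /= -map_comp -[LHS]map_id; apply/eq_in_map => x /lt_s lt_x /=.
by rewrite inordK.
Qed.

(** * The partitions counted by kr2, read from the smallest part *)

(** lo bounds the next part from below, and lor bounds it when it is repeated.
After a single part a the next one is at least a + 2, and at least a + 4 if
repeated; after a repeated part a it is at least a + 4 in both cases. *)
Fixpoint admissible (lo lor : nat) (s : seq nat) : bool :=
  if s is a :: t then
    (lo <= a) &&
    match t with
    | b :: u => if b == a then [&& ~~ odd a, lor <= a & admissible (a + 4) (a + 4) u]
                else admissible (a + 2) (a + 4) t
    | [::] => true
    end
  else true.

Lemma admissible_single lo lor a t : ohead t != Some a ->
  admissible lo lor (a :: t) = (lo <= a) && admissible (a + 2) (a + 4) t.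
Proof. by case: t => // b u /= /negPf; rewrite (inj_eq Some_inj) => ->. Qed.

Lemma admissible_double lo lor a u :
  admissible lo lor [:: a, a & u] =
  [&& lo <= a, ~~ odd a, lor <= a & admissible (a + 4) (a + 4) u].
Proof. by rewrite /= eqxx. Qed.

(** The conditions on kr2 partitions other than the lower bound on the parts; for
sorted parts the distance in the gap condition is a plain difference. *)
Definition gapped (s : seq nat) : Prop :=
  [/\ sorted leq s, forall k, k \in s -> k.+1 \notin s,
      forall k, k \in s -> odd k -> count_mem k s <= 1
    & forall i, i.+2 < size s -> ~~ odd (nth 0 s i.+1) ->
        1 < count_mem (nth 0 s i.+1) s -> nth 0 s i + 4 <= nth 0 s i.+2].

Lemma gapped_double a u :
  gapped [:: a, a & u] <-> [/\ ~~ odd a, gapped u & all (leq (a + 4)) u].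
Proof.
split=> [[srt consec odd1 gap]|[odd_a [srt consec odd1 gap] /allP ge_a]].
  have odd_a : ~~ odd a.
    by apply/negP => /(odd1 a (mem_head _ _)); rewrite /= !eqxx; lia.
  have srt_u : sorted leq u by move: srt => /= /andP[_ /path_sorted].
  have ge_a : all (leq (a + 4)) u.
    case: u srt gap srt_u {consec odd1} => // b u srt gap srt_u.
    have := gap 0 isT; rewrite /= !eqxx => /(_ odd_a isT) ge_b.
    rewrite ge_b /=; move: srt_u; rewrite /= (path_sortedE leq_trans) => /andP[le_b _].
    by apply: sub_all le_b => x; apply: leq_trans.
  have ne_a k : k \in u -> (a == k) = false by move/(allP ge_a); lia.
  split=> //; split=> //.
  - move=> k k_u; have := consec k; rewrite !inE k_u !orbT => /(_ isT).
    by rewrite !negb_or => /and3P[].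
  - by move=> k k_u /(odd1 k); rewrite !inE k_u !orbT /= ne_a // => /(_ isT).
  move=> i lt_i; have := gap i.+2 lt_i; rewrite /= ne_a //.
  by apply: mem_nth; apply: ltnW.
have ne_a k : k \in u -> (a == k) = false by move/ge_a; lia.
split.
- rewrite /= leqnn /= (path_sortedE leq_trans) srt andbT.
  by apply/allP => x /ge_a; lia.
- move=> k; rewrite !inE orbA orbb => /orP[/eqP ->|k_u].
    by rewrite !negb_or; have := ge_a a.+1; case: (_ \in u) => [/(_ isT)|]; lia.
  by rewrite !negb_or consec // andbT; have := ge_a _ k_u; lia.
- move=> k; rewrite !inE orbA orbb => /orP[/eqP ->|k_u odd_k]; first by rewrite (negPf odd_a).
  by rewrite /= ne_a //=; apply: odd1.
case=> [|[|i]] lt_i /=.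
- by move=> _ _; rewrite ge_a // mem_nth.
- by move=> _ _; rewrite ge_a // mem_nth.
by rewrite ne_a; [apply: gap | apply: mem_nth; move: lt_i => /=; lia].
Qed.

Lemma gapped_single a t : ohead t != Some a ->
  gapped (a :: t) <->
  [/\ gapped t, all (leq (a + 2)) t & forall c u, t = [:: c, c & u] -> a + 4 <= c].
Proof.
move=> ne_a; split=> [[srt consec odd1 gap]|[[srt consec odd1 gap] /allP ge_a ge4]].
  have srt_t : sorted leq t by move: srt => /= /path_sorted.
  have ge_a : all (leq (a + 2)) t.
    case: t srt consec srt_t ne_a {gap odd1} => // b u /= /andP[le_ab _] consec srt_t ne_a.
    have ne_b : b != a.+1.
      apply: contraTneq isT => eq_b; have := consec a (mem_head _ _).
      by rewrite eq_b !inE eqxx orbT.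
    have le_b : a + 2 <= b by move: ne_a; rewrite (inj_eq Some_inj); lia.
    rewrite le_b /=; move: srt_t; rewrite (path_sortedE leq_trans) => /andP[le_bu _].
    by apply: sub_all le_bu => x; apply: leq_trans.
  have nm k : k \in t -> (a == k) = false by move/(allP ge_a); lia.
  have odd1t k : k \in t -> odd k -> count_mem k t <= 1.
    by move=> k_t /(odd1 k); rewrite !inE k_t orbT /= nm // => /(_ isT).
  split=> //.
    split=> //.
    - move=> k k_t; have := consec k; rewrite !inE k_t !orbT => /(_ isT).
      by rewrite !negb_or => /andP[].
    move=> i lt_i; have := gap i.+1 lt_i; rewrite /= nm //.
    by apply: mem_nth; apply: ltnW.
  move=> c u def_t; have c_t : c \in t by rewrite def_t mem_head.
  have cnt : 1 < count_mem c t by rewrite def_t /= !eqxx.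
  have even_c : ~~ odd c by apply/negP => /(odd1t c c_t); lia.
  have := gap 0; rewrite /= def_t /= !eqxx => /(_ isT even_c); apply.
  by case: (a == c).
have nm k : k \in t -> (a == k) = false by move/ge_a; lia.
split.
- by rewrite /= (path_sortedE leq_trans) srt andbT; apply/allP => x /ge_a; lia.
- move=> k; rewrite !inE => /orP[/eqP ->|k_t].
    by rewrite negb_or; have := ge_a a.+1; case: (_ \in t) => [/(_ isT)|]; lia.
  by rewrite negb_or consec // andbT; have := ge_a _ k_t; lia.
- move=> k; rewrite !inE => /orP[/eqP -> _|k_t odd_k].
    rewrite /= eqxx (count_memPn _) //; apply/negP => /ge_a; lia.
  by rewrite /= nm //=; apply: odd1.
case=> [|i] lt_i /=; last first.
  by rewrite nm; [apply: gap | apply: mem_nth; move: lt_i => /=; lia].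
case: t srt ge_a ge4 nm lt_i {consec odd1 gap ne_a} => [|c [|d u]] // srt ge_a ge4 nm _ _ /=.
rewrite (nm c (mem_head _ _)) eqxx add0n => rep.
have [eq_d|ne_d] := eqVneq d c; first by rewrite eq_d; apply: ge4; rewrite eq_d.
suff: 0 < count_mem c u.
  rewrite -has_count has_pred1 => c_u; move: srt => /= /andP[le_cd].
  by rewrite (path_sortedE leq_trans) => /andP[/allP/(_ c c_u)]; lia.
by move: rep; rewrite (negPf ne_d).
Qed.

Lemma admissibleP lo lor s : reflect
  [/\ gapped s, all (leq lo) s & forall a u, s = [:: a, a & u] -> lor <= a]
  (admissible lo lor s).
Proof.
have [n] := ubnP (size s); elim: n s lo lor => // n IHn [|a t] lo lor lt_n.
  by left; split=> //; split=> // -[].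
have [head_t|ne_a] := eqVneq (ohead t) (Some a).
  case: t head_t lt_n => // b u [->] lt_n; rewrite admissible_double.
  have lt_u : size u < n by move: lt_n => /=; lia.
  apply: (iffP and4P) => [[le_a odd_a le_a' /IHn[] // gu ge_a _]|[/gapped_double[odd_a gu ge_a] /andP[le_a _] le_a']].
    split; [exact/gapped_double | | by move=> c v; case=> <-].
    by rewrite /= le_a; apply: sub_all ge_a => x; lia.
  split=> //; first exact: le_a' erefl.
  apply/IHn => //; split=> // c v def_u; apply: (allP ge_a).
  by rewrite def_u mem_head.
rewrite admissible_single //.
apply: (iffP andP) => [[le_a /IHn[] // gt ge_a ge4]|[/gapped_single[] // gt ge_a ge4 /andP[le_a _] _]].
  split; first exact/gapped_single.
    by rewrite /= le_a; apply: sub_all ge_a => x; lia.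
  by move=> b u [<- def_t]; rewrite def_t eqxx in ne_a.
by split=> //; apply/IHn.
Qed.

Lemma kr2_admissible s : kr2_partition s = admissible 2 2 s.
Proof.
rewrite /kr2_partition /is_partition; apply/and5P/admissibleP.
  move=> [/andP[srt pos] /allP consec /allP odd1 /allP gap no1].
  have ge2 : all (leq 2) s.
    apply/allP => x x_s; have := allP pos x x_s.
    by have : x != 1 by [apply: contraNneq no1 => <-]; lia.
  split=> //; last first.
    by move=> a u def_s; apply: (allP ge2); rewrite def_s mem_head.
  split=> //; first by move=> k /odd1; rewrite implybE; case: odd.
  move=> i lt_i even_i rep.
  have := gap i; rewrite mem_iota even_i rep /= => /(_ ltac:(lia)).
  have : nth 0 s i <= nth 0 s i.+2.
    by apply: (sorted_leq_nth leq_trans leqnn) => //; rewrite ?inE; lia.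
  lia.
case=> [[srt consec odd1 gap] /allP ge2 _]; split=> //.
- by rewrite srt; apply/allP => x /ge2; lia.
- exact/allP.
- by apply/allP => k /odd1; rewrite implybE; case: odd => //= ->.
- apply/allP => i; rewrite mem_iota => lt_i; apply/implyP => /andP[even_i rep].
  have := gap i ltac:(lia) even_i rep; lia.
by apply/negP => /ge2.
Qed.

(** * Formal power series *)

Local Open Scope ring_scope.

Record fps (R : comNzRingType) := Fps { fcoef : nat -> R }.

HB.instance Definition _ (R : comNzRingType) := gen_eqMixin (fps R).
HB.instance Definition _ (R : comNzRingType) := gen_choiceMixin (fps R).

Lemma fpsP (R : comNzRingType) (f g : fps R) : fcoef f =1 fcoef g -> f = g.
Proof. by case: f g => [f] [g] /= /funext ->. Qed.

Definition fps_trunc (R : comNzRingType) (n : nat) (f : fps R) : {poly R} :=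
  \poly_(i < n.+1) fcoef f i.

Definition fps_add (R : comNzRingType) (f g : fps R) :=
  Fps (fun n => fcoef f n + fcoef g n).
Definition fps_opp (R : comNzRingType) (f : fps R) := Fps (fun n => - fcoef f n).
Definition fps_mul (R : comNzRingType) (f g : fps R) :=
  Fps (fun n => \sum_(i < n.+1) fcoef f i * fcoef g (n - i)).
Definition fps_of_poly (R : comNzRingType) (u : {poly R}) := Fps (fun n => u`_n).

Lemma fps_addA (R : comNzRingType) : associative (@fps_add R).
Proof. by move=> f g h; apply: fpsP => n; apply: addrA. Qed.
Lemma fps_addC (R : comNzRingType) : commutative (@fps_add R).
Proof. by move=> f g; apply: fpsP => n; apply: addrC. Qed.
Lemma fps_add0 (R : comNzRingType) : left_id (fps_of_poly 0) (@fps_add R).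
Proof. by move=> f; apply: fpsP => n /=; rewrite coef0 add0r. Qed.
Lemma fps_addN (R : comNzRingType) :
  left_inverse (fps_of_poly 0) (@fps_opp R) (@fps_add R).
Proof. by move=> f; apply: fpsP => n /=; rewrite coef0 addNr. Qed.

HB.instance Definition _ (R : comNzRingType) :=
  GRing.isZmodule.Build (fps R)
    (@fps_addA R) (@fps_addC R) (@fps_add0 R) (@fps_addN R).

(** The ring laws of power series are inherited from those of polynomials: each
coefficient of a product is a coefficient of the product of truncations. *)
Lemma fps_mul_trunc (R : comNzRingType) (f g : fps R) (k n : nat) :
  (k <= n)%N -> fcoef (fps_mul f g) k = (fps_trunc n f * fps_trunc n g)`_k.
Proof.
move=> le_kn; rewrite coefM; apply: eq_bigr => i _ /=.
by rewrite !coef_poly !ifT //; have := ltn_ord i; lia.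
Qed.

Lemma fps_mulC (R : comNzRingType) : commutative (@fps_mul R).
Proof.
by move=> f g; apply: fpsP => n; rewrite !(fps_mul_trunc _ _ (leqnn n)) mulrC.
Qed.

Lemma fps_mulA (R : comNzRingType) : associative (@fps_mul R).
Proof.
move=> f g h; apply: fpsP => n.
transitivity ((fps_trunc n f * fps_trunc n g * fps_trunc n h)`_n).
  rewrite -mulrA coefM; apply: eq_bigr => i _.
  rewrite (@fps_mul_trunc _ g h _ n) ?leq_subr //.
  by rewrite coef_poly ltn_ord.
rewrite coefM; apply: eq_bigr => i _.
rewrite (@fps_mul_trunc _ f g _ n) -1?ltnS //.
by rewrite coef_poly ltnS leq_subr.
Qed.

Lemma fps_of_polyM (R : comNzRingType) (u v : {poly R}) :
  fps_of_poly (u * v) = fps_mul (fps_of_poly u) (fps_of_poly v).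
Proof. by apply: fpsP => n /=; rewrite coefM. Qed.

Lemma fps_mul1 (R : comNzRingType) : left_id (fps_of_poly 1) (@fps_mul R).
Proof.
move=> f; apply: fpsP => n /=; rewrite big_ord_recl /= coef1 mul1r subn0.
by rewrite big1 ?addr0 // => i _; rewrite coef1 mul0r.
Qed.

Lemma fps_mulDl (R : comNzRingType) : left_distributive (@fps_mul R) +%R.
Proof.
move=> f g h; apply: fpsP => n /=; rewrite -big_split /=.
by apply: eq_bigr => i _; rewrite mulrDl.
Qed.

Lemma fps_1_neq0 (R : comNzRingType) : fps_of_poly 1 != 0 :> fps R.
Proof.
apply/eqP=> /(congr1 (fun f => fcoef f 0)) /=.
by rewrite coef1 coef0 => /eqP; rewrite oner_eq0.
Qed.

HB.instance Definition _ (R : comNzRingType) :=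
  GRing.Zmodule_isComNzRing.Build (fps R)
    (@fps_mulA R) (@fps_mulC R) (@fps_mul1 R) (@fps_mulDl R) (@fps_1_neq0 R).

Lemma fcoefD (R : comNzRingType) (f g : fps R) n :
  fcoef (f + g) n = fcoef f n + fcoef g n.
Proof. by []. Qed.

Lemma fcoefB (R : comNzRingType) (f g : fps R) n :
  fcoef (f - g) n = fcoef f n - fcoef g n.
Proof. by []. Qed.

Lemma fcoef0 (R : comNzRingType) n : fcoef (0 : fps R) n = 0.
Proof. exact: coef0. Qed.

Lemma fcoefM (R : comNzRingType) (f g : fps R) n :
  fcoef (f * g) n = \sum_(i < n.+1) fcoef f i * fcoef g (n - i).
Proof. by []. Qed.

Lemma fcoef_sum (R : comNzRingType) (I : Type) (r : seq I) (Q : pred I)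
    (F : I -> fps R) n :
  fcoef (\sum_(i <- r | Q i) F i) n = \sum_(i <- r | Q i) fcoef (F i) n.
Proof. by elim/big_rec2: _ => [|i x f _ <-]; rewrite ?fcoef0 ?fcoefD. Qed.

Lemma fps_of_poly_is_zmod_morphism (R : comNzRingType) :
  zmod_morphism (@fps_of_poly R).
Proof. by move=> u v; apply: fpsP => n /=; rewrite coefB. Qed.

HB.instance Definition _ (R : comNzRingType) :=
  GRing.isZmodMorphism.Build {poly R} (fps R) (@fps_of_poly R)
    (@fps_of_poly_is_zmod_morphism R).

Lemma fps_of_poly_is_monoid_morphism (R : comNzRingType) :
  monoid_morphism (@fps_of_poly R).
Proof. by split=> // u v; rewrite fps_of_polyM. Qed.

HB.instance Definition _ (R : comNzRingType) :=
  GRing.isMonoidMorphism.Build {poly R} (fps R) (@fps_of_poly R)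
    (@fps_of_poly_is_monoid_morphism R).

Definition fvar (R : comNzRingType) : fps R := fps_of_poly 'X.
Definition fconst (R : comNzRingType) (a : R) : fps R := fps_of_poly a%:P.

Lemma fconst_is_zmod_morphism (R : comNzRingType) : zmod_morphism (@fconst R).
Proof. by move=> a b; rewrite /fconst polyCB rmorphB. Qed.

HB.instance Definition _ (R : comNzRingType) :=
  GRing.isZmodMorphism.Build R (fps R) (@fconst R) (@fconst_is_zmod_morphism R).

Lemma fconst_is_monoid_morphism (R : comNzRingType) : monoid_morphism (@fconst R).
Proof. by split=> [|a b]; rewrite /fconst ?polyC1 ?rmorph1 // polyCM rmorphM. Qed.

HB.instance Definition _ (R : comNzRingType) :=
  GRing.isMonoidMorphism.Build R (fps R) (@fconst R)
    (@fconst_is_monoid_morphism R).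

Lemma fcoefCM (R : comNzRingType) (a : R) (f : fps R) n :
  fcoef (fconst a * f) n = a * fcoef f n.
Proof.
rewrite fcoefM big_ord_recl /= coefC subn0 big1 ?addr0 // => i _.
by rewrite coefC mul0r.
Qed.

Lemma fcoefXnM (R : comNzRingType) (f : fps R) k n :
  fcoef (fvar R ^+ k * f) n = if (n < k)%N then 0 else fcoef f (n - k).
Proof.
rewrite /fvar -rmorphXn -[LHS]/(fcoef (fps_mul (fps_of_poly 'X^k) f) n).
rewrite (fps_mul_trunc _ _ (leqnn n)) coefM; case: ltnP => lt_nk.
  rewrite big1 // => i _; rewrite coef_poly /= coefXn.
  by rewrite (_ : (i : nat) == k = false) ?if_same ?mul0r //; have := ltn_ord i; lia.
rewrite (bigD1 (inord k)) //= !coef_poly inordK // !ltnS lt_nk leq_subr /=.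
rewrite coefXn eqxx mul1r big1 ?addr0 // => i; rewrite -val_eqE /= inordK // => ne_ik.
by rewrite coef_poly /= coefXn (negPf ne_ik) if_same mul0r.
Qed.

Lemma fcoefXM (R : comNzRingType) (f : fps R) n :
  fcoef (fvar R * f) n = if n is n'.+1 then fcoef f n' else 0.
Proof. by rewrite -[fvar R]expr1 fcoefXnM; case: n => [|n]//; rewrite subn1. Qed.

(** The substitution t -> a t. *)
Definition dil (R : comNzRingType) (a : R) (f : fps R) :=
  Fps (fun n => a ^+ n * fcoef f n).

Lemma dil_is_zmod_morphism (R : comNzRingType) (a : R) : zmod_morphism (dil a).
Proof. by move=> f g; apply: fpsP => n /=; rewrite mulrDr mulrN. Qed.

HB.instance Definition _ (R : comNzRingType) (a : R) :=
  GRing.isZmodMorphism.Build (fps R) (fps R) (dil a) (dil_is_zmod_morphism a).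

Lemma dil_is_monoid_morphism (R : comNzRingType) (a : R) : monoid_morphism (dil a).
Proof.
split=> [|f g]; apply: fpsP => n.
  by rewrite /= coef1; case: n => [|n]; rewrite ?mul1r ?mulr0.
rewrite /= mulr_sumr; apply: eq_bigr => i _.
by rewrite mulrACA -exprD subnKC // -ltnS.
Qed.

HB.instance Definition _ (R : comNzRingType) (a : R) :=
  GRing.isMonoidMorphism.Build (fps R) (fps R) (dil a) (dil_is_monoid_morphism a).

Lemma dil_dil (R : comNzRingType) (a b : R) (f : fps R) :
  dil a (dil b f) = dil (a * b) f.
Proof. by apply: fpsP => n /=; rewrite mulrA exprMn. Qed.

Lemma dil1 (R : comNzRingType) (f : fps R) : dil 1 f = f.
Proof. by apply: fpsP => n /=; rewrite expr1n mul1r. Qed.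

Lemma dil_const (R : comNzRingType) (a c : R) : dil a (fconst c) = fconst c.
Proof.
by apply: fpsP => n /=; rewrite coefC; case: n => [|n] /=; rewrite ?mul1r ?mulr0.
Qed.

Lemma dil_var (R : comNzRingType) (a : R) : dil a (fvar R) = fconst a * fvar R.
Proof.
apply: fpsP => n; rewrite fcoefCM /= coefX; case: n => [|[|n]] /=; rewrite ?mulr0 //.
Qed.

Lemma fps_trunc_coefM (R : comNzRingType) (f f' g g' : fps R) n :
    (forall k, (k <= n)%N -> fcoef f k = fcoef f' k) ->
    (forall k, (k <= n)%N -> fcoef g k = fcoef g' k) ->
  fcoef (f * g) n = fcoef (f' * g') n.
Proof.
move=> eq_f eq_g; apply: eq_bigr => i _.
by rewrite eq_f -1?ltnS // eq_g ?leq_subr.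
Qed.

(** * Functional equations in a ring with an endomorphism t -> t p *)

(** The pairs (h_M, k_M): the three terms of h are the continuations of a word
after [0, 0], the four terms of k those after [0, 1]; every continuation
shifts the rest of the word, hence the powers of s. *)
Fixpoint pair_sums (A : comNzRingType) (s : {rmorphism A -> A}) (p t r : A)
    (M : nat) : A * A :=
  if M is M'.+1 then
    let: (h, k) := pair_sums s p t r M' in
    (t ^+ 2 * (p ^+ 2 * s h + p ^+ 4 * s (s h) + p ^+ 3 * s k),
     t ^+ 2 * (p ^+ 4 * s (s h) + p ^+ 3 * s k + p ^+ 5 * s (s k)
               + t * p ^+ 7 * s (s (s h))))
  else (r, r).

(** Here x stands for p^(3M). The recursion along t -> s t at rank M + 1 follows
from the two shift identities at rank M by linear substitution. *)
Lemma pair_sums_recurrences (A : comNzRingType) (s : {rmorphism A -> A})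
    (p t h k h' k' x : A) :
    s p = p -> s t = p * t -> s x = x ->
    x * h = s k + t * p * s (s h) ->
    x * k = s (s h) + t * p ^+ 2 * s (s (s h)) + t * p * s (s k) ->
    h' = t ^+ 2 * (p ^+ 2 * s h + p ^+ 4 * s (s h) + p ^+ 3 * s k) ->
    k' = t ^+ 2 * (p ^+ 4 * s (s h) + p ^+ 3 * s k + p ^+ 5 * s (s k)
               + t * p ^+ 7 * s (s (s h))) ->
  h' = s h' + t * p * s (s h')
       + (1 - p ^+ 3 * x) * t ^+ 2 * (p ^+ 2 * s h + p ^+ 3 * s k)
  /\ k' = h' - (1 - p ^+ 3 * x) * t ^+ 2 * p ^+ 2 * s h.
Proof.
move=> sp st sx /(congr1 s) xh /(congr1 s) xk -> ->.
rewrite !(rmorphM, rmorphD, rmorphXn) /= !(sp, st, sx) in xh xk *.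
rewrite !(rmorphM, rmorphD, rmorphXn) /= !(sp, st, sx) in xh xk *.
split.
  have -> : (1 - p ^+ 3 * x) * t ^+ 2 * (p ^+ 2 * s h + p ^+ 3 * s k)
     = t ^+ 2 * (p ^+ 2 * s h + p ^+ 3 * s k
        - p ^+ 5 * (x * s h) - p ^+ 6 * (x * s k)) by ring.
  by rewrite xh xk; ring.
have -> : (1 - p ^+ 3 * x) * t ^+ 2 * p ^+ 2 * s h
     = t ^+ 2 * (p ^+ 2 * s h - p ^+ 5 * (x * s h)) by ring.
by rewrite xh; ring.
Qed.

(** The shift identities at rank M + 1 follow from the recursion along t -> s t at
the same rank: that recursion expresses every term in the definition of
h_(M+1) and k_(M+1), multiplied by 1 - p^(3M+3), through h_(M+1) and k_(M+1)
themselves. At rank 0 they iterate the Rogers-Ramanujan equation of r. *)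
Lemma pair_sums_shift (A : comNzRingType) (s : {rmorphism A -> A})
    (p t r : A) (M : nat) (h := (pair_sums s p t r M).1)
    (k := (pair_sums s p t r M).2) :
    s p = p -> s t = p * t -> r = s r + t * p * s (s r) ->
  p ^+ (3 * M) * h = s k + t * p * s (s h) /\
  p ^+ (3 * M) * k = s (s h) + t * p ^+ 2 * s (s (s h)) + t * p * s (s k).
Proof.
move=> sp st rr; rewrite /h /k {h k}; elim: M => [|M] /=.
  rewrite muln0 expr0 !mul1r; split=> //.
  rewrite [LHS]rr {1}[in s r]rr !(rmorphM, rmorphD) /= sp st.
  by ring.
case: (pair_sums s p t r M) => h k /= [eqh eqk].
have sx : s (p ^+ (3 * M)) = p ^+ (3 * M) by rewrite rmorphXn /= sp.
have := pair_sums_recurrences sp st sx eqh eqk (erefl _) (erefl _).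
move Eh: (t ^+ 2 * (_ + p ^+ 3 * s k)) => h'.
move Ek: (t ^+ 2 * (_ + _ * s (s (s h)))) => k'.
have -> : p ^+ (3 * M.+1) = p ^+ 3 * p ^+ (3 * M) by rewrite mulnS exprD.
move: (p ^+ (3 * M)) sx eqh eqk => x sx eqh eqk [E1 E2].
(* Each term of h' and k', multiplied by 1 - p^3 x, as a combination of h', k'
   and their images under s. *)
have S2 : t ^+ 2 * p ^+ 2 * s h * (1 - p ^+ 3 * x) = h' - k'.
  by rewrite E2; ring.
have S3 : t ^+ 2 * p ^+ 3 * s k * (1 - p ^+ 3 * x) = k' - s h' - t * p * s (s h').
  rewrite E2 {1}E1; ring.
have T2 : t ^+ 2 * p ^+ 4 * s (s h) * (1 - p ^+ 3 * x) = s h' - s k'.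
  have := congr1 s S2; rewrite !(rmorphM, rmorphN, rmorphD, rmorph1, rmorphXn) /=.
  by rewrite sp st sx => <-; ring.
have U2 : t ^+ 2 * p ^+ 6 * s (s (s h)) * (1 - p ^+ 3 * x) = s (s h') - s (s k').
  have := congr1 s T2; rewrite !(rmorphM, rmorphN, rmorphD, rmorph1, rmorphXn) /=.
  by rewrite sp st sx => <-; ring.
have T3 : t ^+ 2 * p ^+ 5 * s (s k) * (1 - p ^+ 3 * x)
    = s k' - s (s h') - t * p ^+ 2 * s (s (s h')).
  have := congr1 s S3; rewrite !(rmorphM, rmorphN, rmorphD, rmorph1, rmorphXn) /=.
  rewrite sp st sx => E; transitivity (s k' - s (s h') - p * t * p * s (s (s h'))).
    by rewrite -E; ring.
  by ring.
have Dh : h' * (1 - p ^+ 3 * x) = h' - t * p * s (s h') - s k'.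
  transitivity (t ^+ 2 * p ^+ 2 * s h * (1 - p ^+ 3 * x) +
     t ^+ 2 * p ^+ 4 * s (s h) * (1 - p ^+ 3 * x) +
     t ^+ 2 * p ^+ 3 * s k * (1 - p ^+ 3 * x)); first by rewrite -Eh; ring.
  by rewrite S2 T2 S3; ring.
have Dk : k' * (1 - p ^+ 3 * x) = k' - s (s h') - t * p ^+ 2 * s (s (s h'))
    - t * p * s (s k').
  transitivity (t ^+ 2 * p ^+ 4 * s (s h) * (1 - p ^+ 3 * x) +
     t ^+ 2 * p ^+ 3 * s k * (1 - p ^+ 3 * x) +
     t ^+ 2 * p ^+ 5 * s (s k) * (1 - p ^+ 3 * x) +
     t * p * (t ^+ 2 * p ^+ 6 * s (s (s h)) * (1 - p ^+ 3 * x))).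
    by rewrite -Ek; ring.
  by rewrite S3 T2 U2 T3; ring.
split.
  have -> : p ^+ 3 * x * h' = h' - h' * (1 - p ^+ 3 * x) by ring.
  by rewrite Dh; ring.
have -> : p ^+ 3 * x * k' = k' - k' * (1 - p ^+ 3 * x) by ring.
by rewrite Dk; ring.
Qed.

(** With c = 1 / (p^3; p^3)_(M+1), the factor 1 - p^(3M+3) is absorbed. The result
is the recursion of the partitions with M + 1 pairs: the part 1 is absent,
is a singleton, or starts a pair [1, 1] or [1, 2]. *)
Lemma pair_sums_recurrences_scaled (A : comNzRingType) (s : {rmorphism A -> A})
    (p t h k h' k' x c c' : A) :
    s p = p -> s x = x -> s c = c -> c' = (1 - p ^+ 3 * x) * c ->
    h' = s h' + t * p * s (s h')
         + (1 - p ^+ 3 * x) * t ^+ 2 * (p ^+ 2 * s h + p ^+ 3 * s k) ->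
    k' = h' - (1 - p ^+ 3 * x) * t ^+ 2 * p ^+ 2 * s h ->
  c * h' = s (c * h') + t * p * s (s (c * h'))
           + t ^+ 2 * (p ^+ 2 * s (c' * h) + p ^+ 3 * s (c' * k))
  /\ c * k' = c * h' - t ^+ 2 * p ^+ 2 * s (c' * h).
Proof.
move=> sp sx sc -> E1 ->.
rewrite !(rmorphM, rmorphB, rmorph1, rmorphXn) /= !(sp, sx, sc, rmorphM, rmorphXn) /=.
by rewrite ?sc; split; [rewrite {1}E1|]; ring.
Qed.

(** The second-order equation satisfied by h factors: h minus the right-hand side
of the first-order equation is a multiple of t times its own shift. *)
Lemma twice_recurrence (A : comNzRingType) (s : {rmorphism A -> A})
    (p t h k : A) (e := h - (1 + t * p + t ^+ 2 * p ^+ 2) * s h) :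
    s p = p -> s t = p * t ->
    h = s h + t * p * s (s h) + t ^+ 2 * (p ^+ 2 * s h + p ^+ 3 * s k) ->
    k = h - t ^+ 2 * p ^+ 2 * s h ->
  e = t * (- (p * (1 - t * p ^+ 2)) * s e).
Proof.
move=> sp st E1 E2; rewrite /e {e}.
have {E2} := congr1 s E2.
rewrite !(rmorphM, rmorphN, rmorphD, rmorph1, rmorphXn) /= !(sp, st) => E2.
by rewrite {1}E1 E2; ring.
Qed.

(** g, gT and gU are the untwisted versions of the generating functions of the
three classes of adm_shift_system for c = 0. *)
Lemma product_recurrences (A : comNzRingType) (s : {rmorphism A -> A})
    (q t eo ee f : A) (g := eo * ee * f) (gT := (1 - t ^+ 2) * g)
    (gU := s eo * (1 + t * q ^+ 2) * s ee * s f) :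
    s q = q -> s t = q ^+ 2 * t ->
    s eo = (1 - t * q) * eo -> s ee = (1 - t ^+ 2) * ee ->
    f = (1 + t * q ^+ 2 + t ^+ 2 * q ^+ 4) * s f ->
  [/\ g = gT + t ^+ 2 * g, gT = t * (q * gT) + t * (q ^+ 2 * gU) + s g
    & gU = t * (q ^+ 2 * gU) + s gT].
Proof.
move=> sq st seo see sf; rewrite /gU /gT /g; split.
- by ring.
- rewrite rmorphM rmorphM /= seo see {1 2}sf; ring.
rewrite !(rmorphM, rmorphB, rmorph1, rmorphXn) /= st; ring.
Qed.

(** * A linear system for the generating functions of kr2 *)

Fixpoint compositions (N n : nat) : seq (seq nat) :=
  if N is N'.+1 then [seq a :: s | a <- iota 0 n.+1, s <- compositions N' (n - a)]
  else if n == 0%N then [:: [::]] else [::].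

Lemma mem_compositions N n s :
  (s \in compositions N n) = (size s == N) && (sumn s == n).
Proof.
elim: N n s => [|N IHN] n s; first by case: n s => [|n] [|a s].
rewrite -[compositions _ _]/[seq a :: s | a <- iota 0 n.+1, s <- compositions N (n - a)].
apply/idP/andP=> [/allpairsPdep[a [t [a_n t_N ->]]]|[]].
  move: a_n t_N; rewrite mem_iota IHN /= => le_an /andP[/eqP -> /eqP ->].
  by split=> //; apply/eqP; lia.
case: s => // a s size_s /eqP sum_s; apply/allpairsPdep; rewrite /= in size_s sum_s; exists a, s; split=> //.
  by rewrite mem_iota -sum_s ltnS leq_addr.
by rewrite IHN -sum_s addKn eqxx andbT.
Qed.

Lemma compositions_uniq N n : uniq (compositions N n).
Proof.
elim: N n => [|N IHN] n; first by rewrite /=; case: eqP.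
apply: allpairs_uniq_dep => [|a _|]; [exact: iota_uniq | exact: IHN |].
by move=> [a s] [b t] _ _ /= [-> ->].
Qed.

Definition count_series (p : pred (seq nat)) (N : nat) : fps int :=
  Fps (fun n => (count p (compositions N n))%:Z).

Lemma kr2_count_series m n :
  (kr2 n m)%:Z = fcoef (count_series kr2_partition m) n.
Proof.
congr Posz; rewrite /kr2 cardE -size_filter -(size_map (fun t : m.-tuple 'I_n.+1 => map val t)).
apply/perm_size/uniq_perm.
- by rewrite map_inj_uniq ?enum_uniq // => t u /(inj_map val_inj)/val_inj.
- by rewrite filter_uniq ?compositions_uniq.
move=> s; rewrite mem_filter mem_compositions.
apply/mapP/and3P=> [[t]|[kr_s size_s /eqP sum_s]].
  rewrite mem_enum inE => /andP[kr_t sum_t] ->; split=> //.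
  by rewrite size_map size_tuple.
have size_t : size [seq inord x : 'I_n.+1 | x <- s] == m by rewrite size_map.
have def_s : s = map val (Tuple size_t).
  rewrite /= -map_comp -[LHS]map_id; apply/eq_in_map => x x_s /=.
  rewrite inordK // ltnS -sum_s; elim: (s) x_s => //= y u IHu; rewrite inE.
  by case/orP=> [/eqP ->|/IHu]; lia.
by exists (Tuple size_t) => //; rewrite mem_enum inE -def_s kr_s sum_s eqxx.
Qed.

Lemma eq_count_series (p r : pred (seq nat)) N :
  (forall s, size s = N -> p s = r s) -> count_series p N = count_series r N.
Proof.
move=> eq_pr; apply: fpsP => n /=; congr Posz; apply: eq_in_count => s.
by rewrite mem_compositions => /andP[/eqP /eq_pr].
Qed.

Lemma count_seriesD (p p1 p2 : pred (seq nat)) N :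
    (forall s, size s = N -> p s = (p1 s + p2 s)%N :> nat) ->
  count_series p N = count_series p1 N + count_series p2 N.
Proof.
move=> eq_p; apply: fpsP => n; rewrite fcoefD /= -PoszD; congr Posz.
have: all (fun s => size s == N) (compositions N n).
  by apply/allP => s; rewrite mem_compositions => /andP[].
by elim: (compositions N n) => //= s c IHc /andP[/eqP /eq_p -> /IHc ->]; lia.
Qed.

(** Removing the first part, when it is known. *)
Lemma count_series_head (p r : pred (seq nat)) a N :
    (forall b s, b != a -> ~~ p (b :: s)) -> (forall s, p (a :: s) = r s) ->
  count_series p N.+1 = fvar int ^+ a * count_series r N.
Proof.
move=> p_head p_a; apply: fpsP => n; rewrite fcoefXnM /=.
have count0 b t : b != a -> count p [seq b :: s | s <- t] = 0%N.
  by move=> ne_ba; rewrite count_map; apply/eqP; rewrite -leqn0 leqNgt -has_count;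
    apply/hasPn => s _; apply: p_head.
have -> : count p [seq b :: s | b <- iota 0 n.+1, s <- compositions N (n - b)]
    = \sum_(b <- iota 0 n.+1) count p [seq b :: s | s <- compositions N (n - b)].
  elim: (iota 0 n.+1) => [|b t IHt]; first by rewrite big_nil.
  by rewrite big_cons /= count_cat IHt.
case: ltnP => lt_na.
  congr Posz; rewrite big_seq big1 // => b; rewrite mem_iota => lt_bn.
  by apply: count0; lia.
rewrite (bigD1_seq a) ?mem_iota ?iota_uniq //= big1 => [|b ne_ba]; last exact: count0.
by rewrite ?addr0 ?addn0 count_map; congr Posz; apply: eq_count => s; apply: p_a.
Qed.

Lemma count_series0 (p : pred (seq nat)) : p [::] -> count_series p 0 = 1.
Proof.
by move=> p0; apply: fpsP => -[|n] /=; rewrite ?p0 coef1.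
Qed.

Definition adm_series (lo lor N : nat) : fps int := count_series (admissible lo lor) N.

Lemma adm_series0 lo lor : adm_series lo lor 0 = 1.
Proof. exact: count_series0. Qed.

Lemma adm_series_head lo lor N :
  adm_series lo lor N.+1 = adm_series lo.+1 lor N.+1
    + fvar int ^+ lo * count_series (fun t => admissible lo lor (lo :: t)) N.
Proof.
rewrite -(@count_series_head (fun s => (ohead s == Some lo) && admissible lo lor s) _ lo).
- apply: count_seriesD => -[|a t] // _; rewrite [ohead _]/= (inj_eq Some_inj).
  have [->|ne_a] := eqVneq a lo; first by rewrite /= ltnn.
  by rewrite addn0 /=; congr (nat_of_bool (_ && _)); rewrite ltn_neqAle eq_sym ne_a.
- by move=> b s ne_b; rewrite /= (inj_eq Some_inj) (negPf ne_b).
by move=> s; rewrite /= eqxx.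
Qed.

Lemma admissible_cons_single lo lor t : odd lo || (lo < lor)%N ->
  admissible lo lor (lo :: t) = admissible lo.+2 (lo + 4) t.
Proof.
move=> no_rep; have [|ne] := eqVneq (ohead t) (Some lo).
  case: t => // b u [->]; transitivity false.
    by apply/negP; rewrite admissible_double => /and4P[_ even_lo le_lor _]; lia.
  by rewrite /= (_ : (lo.+1 < lo)%N = false) //; lia.
by rewrite admissible_single // leqnn addn2.
Qed.

Lemma adm_series_single lo lor N : odd lo || (lo < lor)%N ->
  adm_series lo lor N.+1
    = adm_series lo.+1 lor N.+1 + fvar int ^+ lo * adm_series lo.+2 (lo + 4) N.
Proof.
move=> no_rep; rewrite adm_series_head; congr (_ + _ * _).
by apply: eq_count_series => t _; apply: admissible_cons_single.
Qed.

Lemma adm_series_double lo lor N : ~~ odd lo -> (lor <= lo)%N ->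
  adm_series lo lor N.+2 = adm_series lo.+1 lor N.+2
    + fvar int ^+ lo * (adm_series lo.+2 (lo + 4) N.+1
                        + fvar int ^+ lo * adm_series (lo + 4) (lo + 4) N).
Proof.
move=> even_lo le_lor; rewrite adm_series_head; congr (_ + _ * _).
rewrite -(@count_series_head (fun t => (ohead t == Some lo) && admissible lo lor (lo :: t)) _ lo).
- apply: count_seriesD => t _; have [|ne] := eqVneq (ohead t) (Some lo).
    case: t => // b u [->]; rewrite [admissible lo.+2 _ _]/= (_ : (lo.+1 < lo)%N = false) //.
    by lia.
  by rewrite admissible_single // leqnn addn2 addn0.
- by move=> b s ne_b; rewrite /= (inj_eq Some_inj) (negPf ne_b).
by move=> s; rewrite admissible_double /= eqxx leqnn even_lo le_lor.
Qed.

Lemma eq_admissible lo lor lor' s :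
    (forall a, (lo <= a)%N -> ~~ odd a -> (lor <= a)%N = (lor' <= a)%N) ->
  admissible lo lor s = admissible lo lor' s.
Proof.
case: s => // a [|b u] //= eq_lor; case: (leqP lo a) => //= le_a.
by case: ifP => // _; case: (boolP (odd a)) => //= /(eq_lor a le_a) ->.
Qed.

Lemma eq_adm_series lo lor lor' N :
    (forall a, (lo <= a)%N -> ~~ odd a -> (lor <= a)%N = (lor' <= a)%N) ->
  adm_series lo lor N = adm_series lo lor' N.
Proof. by move=> eq_lor; apply: eq_count_series => s _; apply: eq_admissible. Qed.

Lemma adm_series_low lo lor N n : (n < lo)%N -> fcoef (adm_series lo lor N.+1) n = 0.
Proof.
move=> lt_n; congr Posz; apply/eqP; rewrite -leqn0 leqNgt -has_count.
apply/hasPn => -[|a s]; rewrite mem_compositions // => /andP[_ /eqP /= sum_s].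
by rewrite (_ : (lo <= a)%N = false) //; lia.
Qed.

(** S, T and U are indexed by the shift c (all parts are about 2c or more) and by
the number of parts. The last condition says that T disappears as c grows. *)
Definition shift_system (S T U : nat -> nat -> fps int) : Prop :=
  [/\ forall c, [/\ S c 0%N = 1, T c 0%N = 1 & U c 0%N = 1],
      forall c N, S c N.+1 = T c N.+1
        + (if N is N'.+1 then fvar int ^+ (4 * c + 4) * S c.+2 N' else 0),
      forall c N, T c N.+1 = fvar int ^+ (2 * c + 2) * T c.+1 N
        + fvar int ^+ (2 * c + 3) * U c.+1 N + S c.+1 N.+1,
      forall c N, U c N.+1 = fvar int ^+ (2 * c + 3) * U c.+1 N + T c.+1 N.+1
    & forall c N n, (n < c)%N -> fcoef (T c N.+1) n = 0].

(** By induction on the number of parts, the difference of two solutions does not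
depend on c; since its coefficients vanish for large c, it is zero. *)
Lemma shift_system_uniq S T U S' T' U' :
  shift_system S T U -> shift_system S' T' U' ->
  forall N c, [/\ S c N = S' c N, T c N = T' c N & U c N = U' c N].
Proof.
move=> [init eqS eqT eqU lowT] [init' eqS' eqT' eqU' lowT'] N.
have [m] := ubnP N; elim: m N => // m IHm [|N] lt_N c.
  by have [-> -> ->] := init c; have [-> -> ->] := init' c.
have IH k d : (k <= N)%N -> [/\ S d k = S' d k, T d k = T' d k & U d k = U' d k].
  by move=> le_k; apply: IHm; lia.
have step d : S d N.+1 - S' d N.+1 = T d N.+1 - T' d N.+1.
  rewrite eqS eqS'; case: N lt_N IH => [|N] lt_N IH; first by rewrite !addr0.
  by have [-> _ _] := IH N d.+2 (leqnSn N); ring.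
have stepT d : T d N.+1 - T' d N.+1 = T d.+1 N.+1 - T' d.+1 N.+1.
  rewrite -[RHS]step eqT eqT'; have [_ -> ->] := IH N d.+1 (leqnn N).
  by ring.
have {stepT} T0 d : T d N.+1 = T' d N.+1.
  apply/eqP; rewrite -subr_eq0; apply/eqP/fpsP => n; rewrite fcoef0.
  (* For c > n the coefficient of q^n vanishes in both solutions. *)
  have -> : T d N.+1 - T' d N.+1 = T (d + n.+1)%N N.+1 - T' (d + n.+1)%N N.+1.
    by elim: n.+1 => [|k IHk]; rewrite ?addn0 // addnS -stepT.
  by rewrite fcoefD /= lowT ?lowT' ?oppr0 ?addr0 //; lia.
split=> //.
  by apply/eqP; rewrite -subr_eq0 step T0 subrr.
by rewrite eqU eqU' T0; have [_ _ ->] := IH N c.+1 (leqnn N).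
Qed.

(** With b = 2c + 2, the three classes have parts at least b without restriction,
parts at least b with b not repeated, and parts at least b + 1 with b + 2 not
repeated. The third one arises after an odd part b - 1. *)
Lemma adm_shift_system :
  shift_system (fun c => adm_series (2 * c + 2) (2 * c + 2))
               (fun c => adm_series (2 * c + 2) (2 * c + 4))
               (fun c => adm_series (2 * c + 3) (2 * c + 5)).
Proof.
have E1 c N : adm_series (2 * c + 3) (2 * c + 4) N.+1
    = adm_series (2 * c + 4) (2 * c + 4) N.+1
      + fvar int ^+ (2 * c + 3) * adm_series (2 * c + 5) (2 * c + 7) N.
  rewrite adm_series_single; last by lia.
  by rewrite !addnS !addn0.
split.
- by move=> c; rewrite !adm_series0.
- move=> c [|N].
    rewrite addr0 [LHS]adm_series_head [RHS]adm_series_head !count_series0 /= ?leqnn //.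
    by congr (_ + _); apply: eq_adm_series => a; lia.
  rewrite adm_series_double; [|lia..].
  rewrite [adm_series _ (2 * c + 4) _]adm_series_single; last by lia.
  rewrite (@eq_adm_series (2 * c + 2).+1 (2 * c + 2) (2 * c + 4)); last by move=> a; lia.
  rewrite mulrDr addrA mulrA -exprD; congr (_ + _ + fvar int ^+ _ * adm_series _ _ _); lia.
- move=> c N; rewrite adm_series_single; last by lia.
  have -> : ((2 * c + 2).+2 = 2 * c + 4)%N by lia.
  have -> : (2 * c + 2 + 4 = 2 * c + 6)%N by lia.
  rewrite -[(2 * c + 2).+1]addnS E1.
  have -> : (2 * c.+1 + 2 = 2 * c + 4)%N by lia.
  have -> : (2 * c.+1 + 4 = 2 * c + 6)%N by lia.
  have -> : (2 * c.+1 + 3 = 2 * c + 5)%N by lia.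
  have -> : (2 * c.+1 + 5 = 2 * c + 7)%N by lia.
  by rewrite addrC [X in _ + X]addrC addrA.
- move=> c N; rewrite adm_series_single; last by lia.
  rewrite addrC; congr (_ * adm_series _ _ _ + _); [lia|lia|].
  rewrite (_ : (2 * c + 3).+1 = 2 * c.+1 + 2)%N; last by lia.
  by apply: eq_adm_series => a; lia.
by move=> c N n lt_n; apply: adm_series_low; lia.
Qed.

(** * The series on the right-hand side *)

Definition quot_series (u d : {poly int}) : fps int := Fps (series_quot u d).

Lemma quot_seriesK (u d : {poly int}) : d`_0 = 1 ->
  fps_of_poly d * quot_series u d = fps_of_poly u.
Proof. by move=> d0; apply: fpsP => n; apply: series_quotP. Qed.

Lemma quot_series_uniq (u d : {poly int}) (f : fps int) : d`_0 = 1 ->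
  fps_of_poly d * f = fps_of_poly u -> quot_series u d = f.
Proof.
move=> d0 df; have dV := quot_seriesK 1 d0; rewrite rmorph1 in dV.
rewrite -[LHS]mul1r -dV mulrAC quot_seriesK // -df.
by rewrite mulrAC dV mul1r.
Qed.

(** Division by a polynomial with constant term 1 is multiplication by an inverse
series, so that quotients can be handled in the ring. *)
Lemma quot_seriesE (u d : {poly int}) : d`_0 = 1 ->
  quot_series u d = fps_of_poly u * quot_series 1 d.
Proof.
by move=> d0; apply: quot_series_uniq; rewrite // mulrCA quot_seriesK // rmorph1 mulr1.
Qed.

Lemma quot_seriesM (d e : {poly int}) : d`_0 = 1 -> e`_0 = 1 ->
  quot_series 1 (d * e) = quot_series 1 d * quot_series 1 e.
Proof.
move=> d0 e0; apply: quot_series_uniq; first by rewrite coef0M d0 e0 mulr1.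
by rewrite rmorphM mulrACA !quot_seriesK // rmorph1 mulr1.
Qed.

Definition inv_qpoch (k n : nat) : fps int := quot_series 1 (qpoch 'X^k 'X^k n).

Lemma fps_of_polyXn (R : comNzRingType) k : fps_of_poly 'X^k = fvar R ^+ k.
Proof. by rewrite rmorphXn. Qed.

Lemma inv_qpoch0 k : inv_qpoch k 0 = 1.
Proof.
apply: quot_series_uniq; first by rewrite /qpoch big_ord0 coef1.
by rewrite mulr1 /qpoch big_ord0.
Qed.

Lemma inv_qpochS k n : (0 < k)%N ->
  inv_qpoch k n = (1 - fvar int ^+ (k * n.+1)) * inv_qpoch k n.+1.
Proof.
move=> k0; apply: quot_series_uniq; first exact: qpoch_coef0.
rewrite mulrA -[RHS](quot_seriesK 1 (qpoch_coef0 n.+1 k0)); congr (_ * _).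
rewrite [in RHS]/qpoch big_ord_recr /= rmorphM -/(qpoch _ _ _); congr (_ * _).
by rewrite -exprS -exprM rmorphB rmorph1 rmorphXn.
Qed.

Definition fps_sum (R : comNzRingType) (u : nat -> fps R) : fps R :=
  Fps (fun n => \sum_(i < n.+1) fcoef (u i) n).

Definition summable (R : comNzRingType) (u : nat -> fps R) : Prop :=
  forall i n, (n < i)%N -> fcoef (u i) n = 0.

Lemma fps_sum_trunc (R : comNzRingType) (u : nat -> fps R) n B :
  summable u -> (n < B)%N -> fcoef (fps_sum u) n = fcoef (\sum_(i < B) u i) n.
Proof.
move=> su lt_nB; rewrite fcoef_sum /= -(subnKC lt_nB) big_split_ord /=.
rewrite [X in _ = _ + X]big1 ?addr0 // => i _; apply: su; lia.
Qed.

Lemma fps_sum_recl (R : comNzRingType) (u : nat -> fps R) : summable u ->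
  fps_sum u = u 0%N + fps_sum (fun i => u i.+1).
Proof.
move=> su; apply: fpsP => n.
rewrite (@fps_sum_trunc _ u n n.+2) // big_ord_recl !fcoefD; congr (_ + _).
by rewrite fcoef_sum.
Qed.

Lemma fps_sumD (R : comNzRingType) (u v : nat -> fps R) :
  fps_sum (fun i => u i + v i) = fps_sum u + fps_sum v.
Proof. by apply: fpsP => n; rewrite fcoefD /= -big_split. Qed.

Lemma fps_sumN (R : comNzRingType) (u : nat -> fps R) :
  fps_sum (fun i => - u i) = - fps_sum u.
Proof. by apply: fpsP => n; rewrite /= sumrN. Qed.

Lemma fps_sum_dil (R : comNzRingType) (a : R) (u : nat -> fps R) :
  fps_sum (fun i => dil a (u i)) = dil a (fps_sum u).
Proof. by apply: fpsP => n; rewrite /= mulr_sumr. Qed.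

Lemma fps_sumM (R : comNzRingType) (g : fps R) (u : nat -> fps R) :
  summable u -> fps_sum (fun i => g * u i) = g * fps_sum u.
Proof.
move=> su; apply: fpsP => n; rewrite -[LHS]/(\sum_(i < n.+1) fcoef (g * u i) n) -fcoef_sum -mulr_sumr.
apply: fps_trunc_coefM => // k le_kn; apply/esym/fps_sum_trunc => //; exact: le_kn.
Qed.

Lemma fps_sum_ext (R : comNzRingType) (u v : nat -> fps R) :
  u =1 v -> fps_sum u = fps_sum v.
Proof. by move=> uv; apply: fpsP => n; apply: eq_bigr => i _; rewrite uv. Qed.

Lemma summableD (R : comNzRingType) (u v : nat -> fps R) :
  summable u -> summable v -> summable (fun i => u i + v i).
Proof. by move=> su sv i n lt_n; rewrite fcoefD su ?sv ?addr0. Qed.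

Lemma summableM (R : comNzRingType) (g : fps R) (u : nat -> fps R) :
  summable u -> summable (fun i => g * u i).
Proof.
move=> su i n lt_n; rewrite fcoefM big1 // => j _; rewrite su ?mulr0 //.
exact: leq_ltn_trans (leq_subr _ _) lt_n.
Qed.

Lemma summable_dil (R : comNzRingType) (a : R) (u : nat -> fps R) :
  summable u -> summable (fun i => dil a (u i)).
Proof. by move=> su i n /su /= ->; rewrite mulr0. Qed.

(** Each coefficient of f is determined by strictly earlier ones. *)
Lemma contraction_eq0 (R : comNzRingType) (a : R) (g f : fps R) :
  f = fvar R * (g * dil a f) -> f = 0.
Proof.
move=> def_f; apply: fpsP => n; rewrite fcoef0.
have [m] := ubnP n; elim: m n => // m IHm [|n] lt_n; rewrite def_f fcoefXM //.
rewrite fcoefM big1 // => i _; rewrite /= IHm ?mulr0 //.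
by move: lt_n; have := ltn_ord i; lia.
Qed.

Local Notation q := (fvar int).
Local Notation p := (fconst (fvar int ^+ 2)).
Local Notation t := (fvar (fps int)).
Local Notation sigma := (dil (fvar int ^+ 2)).

(** The Rogers-Ramanujan series: n moveable singletons after a pair [m, m] or
[m, m + 1] weigh m n + n^2 in total, and 1 / (p; p)_n counts their forward
moves. The term m n comes from the substitution t -> p^m t. *)
Definition rr_series : fps (fps int) :=
  Fps (fun n => q ^+ (2 * n ^ 2) * inv_qpoch 2 n).

Lemma rr_seriesE :
  rr_series = sigma rr_series + t * p * sigma (sigma rr_series).
Proof.
apply: fpsP => n; rewrite fcoefD -mulrA fcoefXM.
case: n => [|n]; first by rewrite addr0 [RHS]mul1r.
rewrite fcoefCM [fcoef (sigma _) n.+1]/= dil_dil [fcoef (dil _ _) _]/= [LHS]/=.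
rewrite (inv_qpochS n (isT : (0 < 2)%N)).
have -> : q ^+ (2 * n.+1) = q ^+ 2 * q ^+ (2 * n) by rewrite -exprD mulnS.
have -> : (q ^+ 2) ^+ n.+1 = q ^+ 2 * q ^+ (2 * n) by rewrite -exprM -exprD mulnS.
have -> : (q ^+ 2 * q ^+ 2) ^+ n = q ^+ (2 * n) * q ^+ (2 * n).
  by rewrite -!exprD -exprM -mulnDl.
have -> : q ^+ (2 * n.+1 ^ 2) = q ^+ 2 * (q ^+ (2 * n) * q ^+ (2 * n) * q ^+ (2 * n ^ 2)).
  by rewrite -!exprD; congr (_ ^+ _); lia.
by move: (q ^+ 2) (q ^+ (2 * n)) (q ^+ (2 * n ^ 2)) (inv_qpoch _ _) => *; ring.
Qed.

Definition sums_h (M : nat) : fps (fps int) := (pair_sums sigma p t rr_series M).1.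
Definition sums_k (M : nat) : fps (fps int) := (pair_sums sigma p t rr_series M).2.

Lemma sigma_p : sigma p = p. Proof. exact: dil_const. Qed.
Lemma sigma_t : sigma t = p * t. Proof. exact: dil_var. Qed.

Lemma sums_hS M : sums_h M.+1 = t ^+ 2 * (p ^+ 2 * sigma (sums_h M)
  + p ^+ 4 * sigma (sigma (sums_h M)) + p ^+ 3 * sigma (sums_k M)).
Proof. by rewrite /sums_h /sums_k /=; case: pair_sums. Qed.

Lemma sums_kS M : sums_k M.+1 = t ^+ 2 * (p ^+ 4 * sigma (sigma (sums_h M))
  + p ^+ 3 * sigma (sums_k M) + p ^+ 5 * sigma (sigma (sums_k M))
  + t * p ^+ 7 * sigma (sigma (sigma (sums_h M)))).
Proof. by rewrite /sums_h /sums_k /=; case: pair_sums. Qed.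

Definition vanishes_below (R : comNzRingType) (n : nat) (f : fps R) : Prop :=
  forall k, (k < n)%N -> fcoef f k = 0.

Lemma vanishes_belowD (R : comNzRingType) n (f g : fps R) :
  vanishes_below n f -> vanishes_below n g -> vanishes_below n (f + g).
Proof. by move=> f0 g0 k lt_k; rewrite fcoefD f0 ?g0 ?addr0. Qed.

Lemma vanishes_belowM (R : comNzRingType) n (g f : fps R) :
  vanishes_below n f -> vanishes_below n (g * f).
Proof.
move=> f0 k lt_k; rewrite fcoefM big1 // => i _; rewrite f0 ?mulr0 //.
exact: leq_ltn_trans (leq_subr _ _) lt_k.
Qed.

Lemma vanishes_below_dil (R : comNzRingType) n (a : R) (f : fps R) :
  vanishes_below n f -> vanishes_below n (dil a f).
Proof. by move=> f0 k lt_k; rewrite /= f0 ?mulr0. Qed.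

Lemma vanishes_below_var (R : comNzRingType) n k (f : fps R) :
  vanishes_below n f -> vanishes_below (k + n) (fvar R ^+ k * f).
Proof.
move=> f0 m lt_m; rewrite fcoefXnM; case: ltnP => // le_k.
by apply: f0; lia.
Qed.

Lemma sums_vanish M :
  vanishes_below (2 * M) (sums_h M) /\ vanishes_below (2 * M) (sums_k M).
Proof.
elim: M => // M [h0 k0]; rewrite sums_hS sums_kS mulnS.
by split; apply: vanishes_below_var;
  do ?[apply: vanishes_belowD]; apply: vanishes_belowM; do ?apply: vanishes_below_dil.
Qed.

(** Dividing by (p^3; p^3)_M accounts for the forward moves of the M pairs, each of
which adds 3 to the weight. *)
Definition norm_h (M : nat) := fconst (inv_qpoch 6 M) * sums_h M.
Definition norm_k (M : nat) := fconst (inv_qpoch 6 M) * sums_k M.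

Lemma summable_h : summable norm_h.
Proof. by move=> M n lt_n; rewrite fcoefCM (sums_vanish M).1 ?mulr0 //; lia. Qed.
Lemma summable_k : summable norm_k.
Proof. by move=> M n lt_n; rewrite fcoefCM (sums_vanish M).2 ?mulr0 //; lia. Qed.

Lemma norm_0 : norm_h 0 = rr_series /\ norm_k 0 = rr_series.
Proof. by rewrite /norm_h /norm_k inv_qpoch0 rmorph1 !mul1r. Qed.

Lemma norm_S M :
  norm_h M.+1 = sigma (norm_h M.+1) + t * p * sigma (sigma (norm_h M.+1))
       + t ^+ 2 * (p ^+ 2 * sigma (norm_h M) + p ^+ 3 * sigma (norm_k M))
  /\ norm_k M.+1 = norm_h M.+1 - t ^+ 2 * p ^+ 2 * sigma (norm_h M).
Proof.
have [eqh eqk] := pair_sums_shift M sigma_p sigma_t rr_seriesE.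
have sx : sigma (p ^+ (3 * M)) = p ^+ (3 * M) by rewrite rmorphXn /= sigma_p.
have := pair_sums_recurrences sigma_p sigma_t sx eqh eqk (sums_hS M) (sums_kS M).
move=> [E1 E2]; apply: pair_sums_recurrences_scaled sigma_p sx _ _ E1 E2.
  exact: dil_const.
rewrite inv_qpochS // rmorphM rmorphB rmorph1 -exprD.
rewrite -[p ^+ (3 + _)](rmorphXn (@fconst (fps int))) -exprM.
by congr ((1 - fconst (_ ^+ _)) * _); lia.
Qed.

Definition twice_series : fps (fps int) := fps_sum norm_h.

Lemma twice_series_recurrences (k := fps_sum norm_k) :
  twice_series = sigma twice_series + t * p * sigma (sigma twice_series)
    + t ^+ 2 * (p ^+ 2 * sigma twice_series + p ^+ 3 * sigma k)
  /\ k = twice_series - t ^+ 2 * p ^+ 2 * sigma twice_series.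
Proof.
have [h0 k0] := norm_0.
have shS : summable (fun M => norm_h M.+1) by move=> i n lt_n; apply: summable_h; lia.
have s1 := summable_dil (q ^+ 2) shS; have s2 := summable_dil (q ^+ 2) s1.
have t1 := summable_dil (q ^+ 2) summable_h; have t2 := summable_dil (q ^+ 2) summable_k.
have tailE : twice_series = rr_series + fps_sum (fun M => norm_h M.+1).
  by rewrite /twice_series (fps_sum_recl summable_h) h0.
split; last first.
  rewrite /k (fps_sum_recl summable_k) k0 {1}tailE -addrA; congr (_ + _).
  rewrite (fps_sum_ext (fun M => (norm_S M).2)) fps_sumD fps_sumN.
  by rewrite (fps_sumM _ t1) fps_sum_dil.
pose S := fps_sum (fun M => norm_h M.+1).
have eqS : S = sigma S + t * p * sigma (sigma S)
    + t ^+ 2 * (p ^+ 2 * sigma twice_series + p ^+ 3 * sigma k).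
  rewrite {1}/S (fps_sum_ext (fun M => (norm_S M).1)) !fps_sumD; congr (_ + _ + _).
  - exact: fps_sum_dil.
  - by rewrite (fps_sumM _ s2) !fps_sum_dil.
  rewrite fps_sumM; last by apply: summableD; apply: summableM.
  congr (_ * _); rewrite fps_sumD; congr (_ + _).
    by rewrite (fps_sumM _ t1) fps_sum_dil.
  by rewrite (fps_sumM _ t2) fps_sum_dil.
have sF : sigma twice_series = sigma rr_series + sigma S by rewrite tailE rmorphD.
have ssF : sigma (sigma twice_series) = sigma (sigma rr_series) + sigma (sigma S).
  by rewrite sF rmorphD.
rewrite ssF {1}sF {1}tailE {1}rr_seriesE -/S {1}eqS.
by rewrite [_ * (sigma (sigma _) + _)]mulrDr [LHS]addrA; congr (_ + _); rewrite addrACA.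
Qed.

Lemma twice_seriesE :
  twice_series = (1 + t * p + t ^+ 2 * p ^+ 2) * sigma twice_series.
Proof.
have [E1 E2] := twice_series_recurrences.
apply/eqP; rewrite -subr_eq0; apply/eqP.
exact: contraction_eq0 (twice_recurrence sigma_p sigma_t E1 E2).
Qed.

Definition odd_series : fps (fps int) := Fps (fun i => q ^+ i * inv_qpoch 2 i).

Definition even_series : fps (fps int) :=
  Fps (fun n => if odd n then 0 else inv_qpoch 4 n./2).

Lemma odd_seriesE : sigma odd_series = (1 - t * fconst q) * odd_series.
Proof.
apply: fpsP => n; rewrite mulrBl mul1r -mulrA fcoefB fcoefXM.
case: n => [|n]; first by rewrite /= !mul1r subr0.
rewrite fcoefCM /= (inv_qpochS n (isT : (0 < 2)%N)).
have -> : q ^+ (2 * n.+1) = (q ^+ 2) ^+ n.+1 by rewrite exprM.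
have -> : q ^+ n.+1 = q * q ^+ n by rewrite exprS.
by move: ((q ^+ 2) ^+ n.+1) (q ^+ n) (inv_qpoch 2 n.+1) => *; ring.
Qed.

Lemma even_seriesE : sigma even_series = (1 - t ^+ 2) * even_series.
Proof.
apply: fpsP => n; rewrite mulrBl mul1r fcoefB fcoefXnM.
case: n => [|[|n]]; rewrite /= ?subr0 ?mulr0 ?mul1r //.
have -> : (n.+2 - 2 = n)%N by lia.
rewrite negbK; case: ifP => odd_n; first by rewrite mulr0 subr0.
rewrite (inv_qpochS n./2 (isT : (0 < 4)%N)).
have -> : (4 * n./2.+1 = 2 * n.+2)%N by rewrite -{2}[n]odd_double_half odd_n; lia.
have -> : q ^+ (2 * n.+2) = (q ^+ 2) ^+ n.+2 by rewrite exprM.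
by move: ((q ^+ 2) ^+ n.+2) (inv_qpoch _ _) => *; ring.
Qed.

Definition kr2_product : fps (fps int) := odd_series * even_series * twice_series.

(** Since (N + k)^2 = N^2 + 2 k N + k^2, the factor q^(N^2) turns multiplication by
t^k into the substitution t -> q^(2k) t followed by multiplication by
q^(k^2) t^k, which is what shifting parts and prepending new ones does. *)
Lemma twisted_shift_system :
  exists S T U, shift_system S T U /\
    forall N, S 0%N N = q ^+ (N ^ 2) * fcoef kr2_product N.
Proof.
have sq : sigma (fconst q) = fconst q by exact: dil_const.
have def_p : p = fconst q ^+ 2 by rewrite rmorphXn.
have st : sigma t = fconst q ^+ 2 * t by rewrite -def_p; exact: dil_var.
have ef : twice_series = (1 + t * fconst q ^+ 2 + t ^+ 2 * fconst q ^+ 4) * sigma twice_series.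
  by rewrite (exprM _ 2 2) -def_p; exact: twice_seriesE.
have := product_recurrences sq st odd_seriesE even_seriesE ef.
rewrite -/kr2_product.
set gT := (1 - t ^+ 2) * _; set gU := (sigma odd_series * _ * _ * _) => -[E1 E2 E3].
pose tw (g : fps (fps int)) c N := q ^+ (N ^ 2 + 2 * c * N) * fcoef g N.
exists (tw kr2_product), (tw gT), (tw gU); split; last first.
  by move=> N; rewrite /tw muln0 mul0n addn0.
have g0 : fcoef kr2_product 0 = 1.
  rewrite /kr2_product fcoefM big_ord1 fcoefM big_ord1 !subn0.
  rewrite -[fcoef twice_series 0]/(\sum_(i < 1) fcoef (norm_h i) 0) big_ord1.
  by rewrite norm_0.1 /= !inv_qpoch0 !mulr1.
have gT0 : fcoef gT 0 = 1.
  by rewrite -g0 [in RHS]E1 fcoefD fcoefXnM addr0.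
have gU0 : fcoef gU 0 = 1.
  by rewrite E3 fcoefD fcoefXM add0r /= mul1r.
split.
- by move=> c; rewrite /tw g0 gT0 gU0 muln0 expr0 mulr1.
- move=> c N; rewrite {1}/tw {1}E1 fcoefD mulrDr fcoefXnM; congr (_ + _).
  case: N => [|N]; first by rewrite mulr0.
  rewrite [RHS]mulrA -exprD (_ : (N.+2 - 2 = N)%N); last by lia.
  by congr (_ ^+ _ * _); lia.
- move=> c N; rewrite {1}/tw {1}E2 2!fcoefD !fcoefXM 2!mulrDr /tw; congr (_ + _ + _).
  + by rewrite fcoefCM [LHS]mulrA [RHS]mulrA -exprSr -exprD; congr (_ ^+ _ * _); lia.
  + rewrite -(rmorphXn (@fconst (fps int))) fcoefCM [LHS]mulrA [RHS]mulrA -!exprD.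
    by congr (_ ^+ _ * _); lia.
  rewrite /= mulrA -exprM -exprD; congr (_ ^+ _ * _); lia.
- move=> c N; rewrite {1}/tw {1}E3 fcoefD fcoefXM mulrDr /tw; congr (_ + _).
  + rewrite -(rmorphXn (@fconst (fps int))) fcoefCM [LHS]mulrA [RHS]mulrA -!exprD.
    by congr (_ ^+ _ * _); lia.
  rewrite /= mulrA -exprM -exprD; congr (_ ^+ _ * _); lia.
move=> c N n lt_n; rewrite /tw fcoefXnM ifT //; lia.
Qed.

(** * Assembling the sum *)

Lemma kr2_fcoef n N : (kr2 n N)%:Z = fcoef (q ^+ (N ^ 2) * fcoef kr2_product N) n.
Proof.
have [S [T [U [sys S0]]]] := twisted_shift_system.
rewrite kr2_count_series -S0; have [<- _ _] := shift_system_uniq adm_shift_system sys N 0.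
by congr (fcoef _ n); apply: eq_count_series => s _; apply: kr2_admissible.
Qed.

Definition chain_term (x : nat) (gs : seq group) : fps (fps int) :=
  p ^+ sumn (ungroup gs) * t ^+ size (ungroup gs)
  * dil ((q ^+ 2) ^+ last_pair_start x gs) rr_series.

Lemma chain_term_cat b x g b' x' gs : (g, (b', x')) \in next_groups b x ->
  chain_term x (g ++ gs)
  = p ^+ sumn (ungroup g) * t ^+ size (ungroup g) * chain_term x' gs.
Proof.
move=> in_g; rewrite /chain_term (last_pair_start_next _ in_g) ungroup_cat.
by rewrite sumn_cat size_cat !exprD mulrA; congr (_ * _); rewrite mulrACA.
Qed.

Lemma dil_pX x (f : fps (fps int)) :
  dil ((q ^+ 2) ^+ x.+1) f = dil ((q ^+ 2) ^+ x) (sigma f).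
Proof. by rewrite dil_dil exprSr. Qed.

Lemma sum_next_groups (A : comNzRingType) (W : seq group -> A) (D : bool * nat -> A) b x :
  \sum_(e <- next_groups b x) W e.1 * D e.2 =
  if b then W [:: Pair x.+2 x.+2] * D (false, x.+2)
            + W [:: Pair x.+1 x.+2] * D (true, x.+1)
            + W [:: Pair x.+2 x.+3] * D (true, x.+2)
            + W [:: Single x.+1; Pair x.+3 x.+3] * D (false, x.+3)
  else W [:: Pair x.+1 x.+1] * D (false, x.+1)
       + W [:: Pair x.+2 x.+2] * D (false, x.+2)
       + W [:: Pair x.+1 x.+2] * D (true, x.+1).
Proof. by case: b; rewrite !big_cons big_nil /= addr0 !addrA. Qed.

Lemma rescaled_step_k (A : comNzRingType) (d : {rmorphism A -> A})
    (p t y h2 k1 k2 h3 : A) : d p = p -> d t = y * t ->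
  y * p * p * (y * p * p) * t ^+ 2 * d h2 + y * p * (y * p * p) * t ^+ 2 * d k1
  + y * p * p * (y * p * p * p) * t ^+ 2 * d k2
  + y * p * (y * p * p * p) * (y * p * p * p) * t ^+ 3 * d h3
  = d (t ^+ 2 * (p ^+ 4 * h2 + p ^+ 3 * k1 + p ^+ 5 * k2 + t * p ^+ 7 * h3)).
Proof.
by move=> dp dt; rewrite !(rmorphM, rmorphD, rmorphXn) /= !(dp, dt); ring.
Qed.

Lemma rescaled_step_h (A : comNzRingType) (d : {rmorphism A -> A})
    (p t y h1 h2 k1 : A) : d p = p -> d t = y * t ->
  y * p * (y * p) * t ^+ 2 * d h1 + y * p * p * (y * p * p) * t ^+ 2 * d h2
  + y * p * (y * p * p) * t ^+ 2 * d k1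
  = d (t ^+ 2 * (p ^+ 2 * h1 + p ^+ 4 * h2 + p ^+ 3 * k1)).
Proof.
by move=> dp dt; rewrite !(rmorphM, rmorphD, rmorphXn) /= !(dp, dt); ring.
Qed.

(** A word starting at x instead of 0 has all its parts shifted by x. *)
Lemma chain_sum M b x :
  \sum_(gs <- chains M b x) chain_term x gs
  = dil ((q ^+ 2) ^+ x) (if b then sums_k M else sums_h M).
Proof.
elim: M b x => [|M IHM] b x.
  rewrite big_seq1 /chain_term !expr0 !mul1r.
  by rewrite (_ : sums_k 0 = rr_series) // (_ : sums_h 0 = rr_series) // if_same.
rewrite big_allpairs_dep.
pose W g := p ^+ sumn (ungroup g) * t ^+ size (ungroup g).
pose D (e : bool * nat) := dil ((q ^+ 2) ^+ e.2) (if e.1 then sums_k M else sums_h M).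
transitivity (\sum_(e <- next_groups b x) W e.1 * D e.2).
  rewrite big_seq [RHS]big_seq; apply: eq_bigr => -[g [b' x']] in_g.
  rewrite /D -IHM mulr_sumr; apply: eq_bigr => gs _; exact: chain_term_cat in_g.
have W1 a e : W [:: Pair a e] = p ^+ a * p ^+ e * t ^+ 2.
  by rewrite /W /= addn0 exprD.
have W2 : W [:: Single x.+1; Pair x.+3 x.+3] = p ^+ x.+1 * p ^+ x.+3 * p ^+ x.+3 * t ^+ 3.
  by rewrite /W /= addn0 !exprD !mulrA.
have D1 e : D e = dil ((q ^+ 2) ^+ e.2) (if e.1 then sums_k M else sums_h M) by [].
rewrite sum_next_groups W2 !W1 !D1 {W D W1 W2 D1}.
have dilt : dil ((q ^+ 2) ^+ x) t = p ^+ x * t by rewrite dil_var rmorphXn.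
have dilp : dil ((q ^+ 2) ^+ x) p = p by exact: dil_const.
have pS n : p ^+ n.+1 = p ^+ n * p by rewrite exprSr.
have d1 := dil_pX x.
have d2 f : dil ((q ^+ 2) ^+ x.+2) f = dil ((q ^+ 2) ^+ x) (sigma (sigma f)).
  by rewrite dil_pX d1.
have d3 f : dil ((q ^+ 2) ^+ x.+3) f = dil ((q ^+ 2) ^+ x) (sigma (sigma (sigma f))).
  by rewrite dil_pX d2.
case: b; cbv beta iota delta [fst snd].
  by rewrite d3 !d2 d1 !pS sums_kS; apply: rescaled_step_k.
by rewrite d1 !d2 d1 !pS sums_hS; apply: rescaled_step_h.
Qed.

Lemma sum_delta (V : nmodType) K a (F : nat -> V) : (a < K)%N ->
  \sum_(i <- iota 0 K) (if a == i then F i else 0) = F a.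
Proof.
move=> lt_a; rewrite (bigD1_seq a) ?mem_iota ?iota_uniq //= eqxx big1 ?addr0 // => i ne_i.
by rewrite eq_sym (negPf ne_i).
Qed.

Lemma fcoef_monomial (c : fps int) e N :
  fcoef (fconst c * t ^+ e) N = if N == e then c else 0.
Proof.
rewrite fcoefCM -[t ^+ e]mulr1 fcoefXnM; case: ltngtP => [_|lt_e|->] //; rewrite ?mulr0 //.
  by rewrite /= coef1 (_ : (N - e == 0)%N = false) ?mulr0 //; lia.
by rewrite subnn /= coef1 mulr1.
Qed.

Lemma monomialM (a b : fps int) (m n : nat) :
  fconst a * t ^+ m * (fconst b * t ^+ n) = fconst (a * b) * t ^+ (m + n).
Proof. by rewrite rmorphM exprD mulrACA. Qed.

Definition sum_index := (nat * nat * nat * nat * nat * nat * nat)%type.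

Definition box_extend (T : eqType) (s : seq T) (K : nat) : seq (T * nat) :=
  [seq (x, k) | x <- s, k <- iota 0 K].

Lemma mem_box_extend (T : eqType) (s : seq T) K x k :
  ((x, k) \in box_extend s K) = (x \in s) && (k < K)%N.
Proof.
apply/allpairsP/andP=> [[[y l] /= [y_s l_K [-> ->]]]|[x_s k_K]].
  by move: l_K; rewrite mem_iota.
by exists (x, k); rewrite mem_iota.
Qed.

Lemma box_extend_uniq (T : eqType) (s : seq T) K : uniq s -> uniq (box_extend s K).
Proof.
move=> uniq_s; apply: allpairs_uniq => //; first exact: iota_uniq.
by move=> [x k] [y l].
Qed.

Lemma sum_box_extend (V : nmodType) (T : eqType) (s : seq T) K (F : T * nat -> V) :
  \sum_(x <- box_extend s K) F x = \sum_(x <- s) \sum_(k <- iota 0 K) F (x, k).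
Proof. exact: big_allpairs. Qed.

Definition box (K : nat) : seq sum_index :=
  box_extend (box_extend (box_extend (box_extend (box_extend
    (box_extend (iota 0 K) K) K) K) K) K) K.

Lemma box_uniq K : uniq (box K).
Proof. by do 6!apply: box_extend_uniq; apply: iota_uniq. Qed.

Lemma mem_box K m1 m2 m3 m n12 i j : ((m1, m2, m3, m, n12, i, j) \in box K) =
  [&& m1 < K, m2 < K, m3 < K, m < K, n12 < K, i < K & j < K]%N.
Proof. by rewrite !mem_box_extend mem_iota /= -!andbA. Qed.

Definition pair_part (m1 m2 m3 m : nat) : fps (fps int) :=
  fconst (fps_of_poly (P m1 m2 m3 (m%:Z + 1) \Po 'X^2) * inv_qpoch 6 (m1 + m2 + 2 * m3))
  * t ^+ (2 * m1 + 2 * m2 + 5 * m3).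
Definition single_part (m n12 : nat) : fps (fps int) :=
  fconst (q ^+ (2 * m * n12 + 2 * n12 ^ 2) * inv_qpoch 2 n12) * t ^+ n12.
Definition odd_part (i : nat) : fps (fps int) :=
  fconst (q ^+ i * inv_qpoch 2 i) * t ^+ i.
Definition even_part (j : nat) : fps (fps int) :=
  fconst (inv_qpoch 4 j) * t ^+ (2 * j).

Lemma kr2_summandE m1 m2 m3 m n12 i j n N :
  kr2_summand m1 m2 m3 m n12 i j n N = fcoef (q ^+ (N ^ 2)
    * fcoef (pair_part m1 m2 m3 m * single_part m n12 * odd_part i * even_part j) N) n.
Proof.
rewrite /kr2_summand /qt_shift /pair_part /single_part /odd_part /even_part.
set Pm := fps_of_poly _; set e := (_ + 2 * j)%N.
rewrite !monomialM fcoef_monomial -/e; case: eqP => [->|_]; last by rewrite mulr0 fcoef0.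
set d := (_ * qpoch 'X^4 'X^4 j); set u := (_ * 'X^_).
have h2 k := @qpoch_coef0 2 k isT; have h6 k := @qpoch_coef0 6 k isT.
have h4 k := @qpoch_coef0 4 k isT.
rewrite -[LHS]/(fcoef (quot_series u d) n) /d quot_seriesE; last by rewrite !coef0M !(h2, h4, h6) !mulr1.
rewrite !quot_seriesM; try by rewrite ?coef0M !(h2, h4, h6) ?mulr1.
have -> : fps_of_poly u = Pm * q ^+ (2 * m * n12 + 2 * n12 ^ 2 + i + e ^ 2).
  by rewrite /u rmorphM rmorphXn.
rewrite -!/(inv_qpoch _ _).
have -> : q ^+ (2 * m * n12 + 2 * n12 ^ 2 + i + e ^ 2)
    = q ^+ (2 * m * n12 + 2 * n12 ^ 2) * q ^+ i * q ^+ (e ^ 2) by rewrite -!exprD.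
move: (q ^+ (2 * m * n12 + 2 * n12 ^ 2)) (q ^+ i) (q ^+ (e ^ 2)) => x y z.
move: (inv_qpoch 2 n12) (inv_qpoch 6 _) (inv_qpoch 2 i) (inv_qpoch 4 j) => a b c g.
by congr (fcoef _ n); ring.
Qed.

Lemma pair_part_chains m1 m2 m3 m :
  pair_part m1 m2 m3 m = \sum_(gs <- chains (m1 + m2 + 2 * m3) false 0
                              | chain_index m1 m2 m3 (m%:Z + 1) gs)
    fconst (inv_qpoch 6 (m1 + m2 + 2 * m3))
    * (p ^+ sumn (ungroup gs) * t ^+ size (ungroup gs)).
Proof.
rewrite /pair_part [fps_of_poly _](_ : _ =
    \sum_(gs <- chains (m1 + m2 + 2 * m3) false 0 | chain_index m1 m2 m3 (m%:Z + 1) gs)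
      (q ^+ 2) ^+ sumn (ungroup gs)); last first.
  rewrite P_chains raddf_sum rmorph_sum; apply: eq_bigr => gs _.
  by rewrite /= comp_Xn_poly !rmorphXn.
rewrite mulr_suml rmorph_sum mulr_suml big_seq_cond [RHS]big_seq_cond.
apply: eq_bigr => gs /andP[in_gs /and4P[/eqP nb /eqP nr /eqP nc _]].
have [_] := start_chain_stats in_gs; rewrite nb nr nc => <-.
have fconstM (a b : fps int) : fconst (a * b) = fconst a * fconst b by exact: rmorphM.
have fconstX (a : fps int) l : fconst (a ^+ l) = fconst a ^+ l by exact: rmorphXn.
by rewrite -[X in X * _ = _]/(fconst _) fconstM fconstX [_ * fconst _]mulrC mulrA.
Qed.

Lemma odd_part_sum K k : (k < K)%N ->
  fcoef (\sum_(i <- iota 0 K) odd_part i) k = fcoef odd_series k.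
Proof.
move=> lt_k; rewrite fcoef_sum.
under eq_bigr => i _ do rewrite fcoef_monomial.
by rewrite sum_delta.
Qed.

Lemma even_part_sum K k : (k < K)%N ->
  fcoef (\sum_(j <- iota 0 K) even_part j) k = fcoef even_series k.
Proof.
move=> lt_k; rewrite fcoef_sum.
under eq_bigr => j _ do rewrite fcoef_monomial.
rewrite [RHS]/=; case: ifPn => odd_k.
  by rewrite big1 // => j _; case: eqP => // def_k; rewrite def_k oddM in odd_k.
have def_k : k = (2 * k./2)%N by have := odd_double_half k; rewrite (negPf odd_k); lia.
rewrite -(@sum_delta _ K k./2 (fun j => inv_qpoch 4 j)); last by lia.
by apply: eq_bigr => j _; rewrite {1}def_k eqn_pmul2l.
Qed.

Lemma single_part_sum m K k : (k < K)%N ->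
  fcoef (\sum_(n12 <- iota 0 K) single_part m n12) k
  = fcoef (dil ((q ^+ 2) ^+ m) rr_series) k.
Proof.
move=> lt_k; rewrite fcoef_sum.
under eq_bigr => i _ do rewrite fcoef_monomial.
by rewrite sum_delta // [RHS]/= mulrA -!exprM exprD.
Qed.

Lemma sum_delta4 (V : nmodType) K a b c d (z : V) :
    (a < K)%N -> (b < K)%N -> (c < K)%N -> (d < K)%N ->
  \sum_(i <- iota 0 K) \sum_(j <- iota 0 K) \sum_(k <- iota 0 K) \sum_(l <- iota 0 K)
    (if [&& a == i, b == j, c == k & d == l] then z else 0) = z.
Proof.
move=> lt_a lt_b lt_c lt_d.
rewrite -[RHS](@sum_delta _ K a (fun=> z)) //; apply: eq_bigr => i _.
case: (a == i) => /=; last by do 3!rewrite big1 // => ? _.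
rewrite -[RHS](@sum_delta _ K b (fun=> z)) //; apply: eq_bigr => j _.
case: (b == j) => /=; last by do 2!rewrite big1 // => ? _.
rewrite -[RHS](@sum_delta _ K c (fun=> z)) //; apply: eq_bigr => k _.
case: (c == k) => /=; last by rewrite big1 // => ? _.
by rewrite (@sum_delta _ K d (fun=> z)).
Qed.

Lemma exchange_sum4 (V : nmodType) (I : Type) (r : seq I) (s : seq nat)
    (F : nat -> nat -> nat -> nat -> I -> V) :
  \sum_(i <- s) \sum_(j <- s) \sum_(k <- s) \sum_(l <- s) \sum_(y <- r) F i j k l y
  = \sum_(y <- r) \sum_(i <- s) \sum_(j <- s) \sum_(k <- s) \sum_(l <- s) F i j k l y.
Proof.
do 3!(rewrite [RHS]exchange_big; apply: eq_bigr => ? _).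
by rewrite [RHS]exchange_big.
Qed.

(** The words are sorted by their values of m1, m2, m3, m. The bound 3N on m is
enough because a word with at most N pairs ends at most at 3N; the words with
more pairs have more than N parts. *)
Lemma twice_part_sum N k (K := (3 * N).+1) : (k <= N)%N ->
  fcoef (\sum_(m1 <- iota 0 K) \sum_(m2 <- iota 0 K) \sum_(m3 <- iota 0 K)
         \sum_(m <- iota 0 K)
           pair_part m1 m2 m3 m * \sum_(n12 <- iota 0 K) single_part m n12) k
  = fcoef twice_series k.
Proof.
move=> le_kN; have lt_kK : (k < K)%N by rewrite /K; lia.
pose B := (4 * K)%N.
pose z M gs := fcoef (fconst (inv_qpoch 6 M) * chain_term 0 gs) k.
have z0 M gs : (N < M)%N -> gs \in chains M false 0 -> z M gs = 0.
  move=> lt_NM in_gs; rewrite /z /chain_term fcoefCM -mulrA.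
  rewrite (vanishes_belowM (n := k.+1)) ?mulr0 // => l lt_l.
  rewrite fcoefXnM ifT //.
  by have [] := start_chain_stats in_gs; lia.
(* B exceeds every value of m1 + m2 + 2 m3 in the box. *)
transitivity (\sum_(M <- iota 0 B) \sum_(gs <- chains M false 0) z M gs); last first.
  rewrite /twice_series (fps_sum_trunc (B := B) summable_h); last by rewrite /B; lia.
  rewrite -(big_mkord xpredT norm_h) /index_iota subn0 fcoef_sum; apply: eq_bigr => M _.
  rewrite /norm_h -[sums_h M]dil1 -[1](expr0 (q ^+ 2)).
  by rewrite -(chain_sum M false 0) mulr_sumr fcoef_sum.
have term m1 m2 m3 m : (m1 < K)%N -> (m2 < K)%N -> (m3 < K)%N ->
    fcoef (pair_part m1 m2 m3 m * \sum_(n12 <- iota 0 K) single_part m n12) k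
    = \sum_(M <- iota 0 B) \sum_(gs <- chains M false 0)
        (if [&& num_free_repeating gs == m1, num_free_consecutive gs == m2,
                num_blocks gs == m3 & last_pair_start 0 gs == m] then z M gs else 0).
  move=> lt1 lt2 lt3; pose M0 := (m1 + m2 + 2 * m3)%N.
  rewrite [RHS](bigD1_seq M0) ?iota_uniq ?mem_iota; [|by rewrite /M0 /B; lia|by []].
  rewrite [X in _ = _ + X]big1 => [|M ne_M]; last first.
    rewrite big_seq big1 // => gs in_gs; case: and4P => // -[/eqP nr /eqP nc /eqP nb _].
    have [def_M _] := start_chain_stats in_gs.
    by case/eqP: ne_M; rewrite -def_M nr nc nb.
  rewrite addr0 pair_part_chains -/M0 mulr_suml fcoef_sum big_mkcond.
  apply: eq_bigr => gs _; rewrite /chain_index (inj_eq (addIr _)) [(_ == m)%R]/=.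
  rewrite (_ : [&& _, _, _ & _] = [&& num_free_repeating gs == m1,
    num_free_consecutive gs == m2, num_blocks gs == m3 & last_pair_start 0 gs == m]).
    case: and4P => // -[_ _ _ /eqP <-].
    rewrite /z /chain_term [in RHS]mulrA; apply: fps_trunc_coefM => // l le_l.
    by apply: single_part_sum; lia.
  by case: (num_blocks gs == m3); rewrite ?andbT ?andbF.
transitivity (\sum_(m1 <- iota 0 K) \sum_(m2 <- iota 0 K) \sum_(m3 <- iota 0 K)
    \sum_(m <- iota 0 K) \sum_(M <- iota 0 B) \sum_(gs <- chains M false 0)
      (if [&& num_free_repeating gs == m1, num_free_consecutive gs == m2,
              num_blocks gs == m3 & last_pair_start 0 gs == m] then z M gs else 0)).
  rewrite fcoef_sum big_seq [RHS]big_seq; apply: eq_bigr => m1; rewrite mem_iota => lt1.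
  rewrite fcoef_sum big_seq [RHS]big_seq; apply: eq_bigr => m2; rewrite mem_iota => lt2.
  rewrite fcoef_sum big_seq [RHS]big_seq; apply: eq_bigr => m3; rewrite mem_iota => lt3.
  by rewrite fcoef_sum; apply: eq_bigr => m _; apply: term; lia.
rewrite exchange_sum4; apply: eq_bigr => M _.
rewrite exchange_sum4 big_seq [RHS]big_seq; apply: eq_bigr => gs in_gs.
case: (ltnP N M) => [lt_NM|le_MN].
  by rewrite (z0 _ _ lt_NM in_gs); do 4!(rewrite big1 // => ? _); rewrite if_same.
have [def_M _] := start_chain_stats in_gs; have := last_pair_start_le in_gs.
by move=> le_m; apply: sum_delta4; rewrite /K; lia.
Qed.

Lemma box_sum N (K := (3 * N).+1) :
  fcoef (\sum_(x <- box K)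
    (let: (m1, m2, m3, m, n12, i, j) := x in
     pair_part m1 m2 m3 m * single_part m n12 * odd_part i * even_part j)) N
  = fcoef kr2_product N.
Proof.
rewrite !sum_box_extend.
transitivity (fcoef ((\sum_(m1 <- iota 0 K) \sum_(m2 <- iota 0 K)
    \sum_(m3 <- iota 0 K) \sum_(m <- iota 0 K)
           pair_part m1 m2 m3 m * \sum_(n12 <- iota 0 K) single_part m n12)
    * (\sum_(i <- iota 0 K) odd_part i) * (\sum_(j <- iota 0 K) even_part j)) N).
  congr (fcoef _ N); rewrite !mulr_suml; apply: eq_bigr => m1 _.
  rewrite !mulr_suml; apply: eq_bigr => m2 _.
  rewrite !mulr_suml; apply: eq_bigr => m3 _.
  rewrite !mulr_suml; apply: eq_bigr => m _.
  rewrite [_ * \sum_(n12 <- _) single_part m n12]mulr_sumr !mulr_suml.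
  apply: eq_bigr => n12 _.
  rewrite [_ * \sum_(i <- _) odd_part i]mulr_sumr mulr_suml; apply: eq_bigr => i _.
  by rewrite mulr_sumr.
transitivity (fcoef (twice_series * odd_series * even_series) N); last first.
  by rewrite /kr2_product -mulrA mulrC.
apply: fps_trunc_coefM => k le_k; last by apply: even_part_sum; rewrite /K; lia.
apply: fps_trunc_coefM => l le_l; last by apply: odd_part_sum; rewrite /K; lia.
by apply: twice_part_sum; lia.
Qed.

Lemma P_eq0 m1 m2 m3 m : (3 * (m1 + m2 + 2 * m3) < m)%N -> P m1 m2 m3 (m%:Z + 1) = 0.
Proof.
move=> lt_m; rewrite P_chains big_seq_cond big1 // => gs /andP[in_gs /and4P[_ _ _]].
rewrite (inj_eq (addIr _)) => /eqP[eq_m].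
by have := last_pair_start_le in_gs; lia.
Qed.

Lemma kr2_formal_sum :
  has_formal_sum
    (fun x : sum_index => let: (m1, m2, m3, m, n12, i, j) := x in
       kr2_summand m1 m2 m3 m n12 i j)
    (fun n m : nat => (kr2 n m)%:Z).
Proof.
move=> n N; exists (box (3 * N).+1); split; first exact: box_uniq.
  move=> [[[[[[m1 m2] m3] m] n12] i] j]; rewrite mem_box => out.
  rewrite /kr2_summand /qt_shift; case: eqP => // def_N.
  rewrite P_eq0; last by move: out; rewrite !negb_and -!leqNgt; lia.
  by rewrite comp_poly0 mul0r /series_quot mul0r coef0.
rewrite kr2_fcoef -box_sum fcoef_sum mulr_sumr fcoef_sum.
by apply: eq_bigr => -[[[[[[m1 m2] m3] m] n12] i] j] _; apply: kr2_summandE.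
Qed.

Definition nonneg_series (f : fps int) : Prop := forall n, 0 <= fcoef f n.

Lemma nonneg_seriesM (f g : fps int) :
  nonneg_series f -> nonneg_series g -> nonneg_series (f * g).
Proof. by move=> f0 g0 n; rewrite fcoefM; apply: sumr_ge0 => i _; apply: mulr_ge0. Qed.

Lemma inv_qpoch_nonneg k n : (0 < k)%N -> nonneg_series (inv_qpoch k n).
Proof.
move=> k0; elim: n => [|n IHn] m; first by rewrite inv_qpoch0 /= coef1; case: eqP.
have [l] := ubnP m; elim: l m => // l IHl m lt_m.
have -> : inv_qpoch k n.+1 = inv_qpoch k n + q ^+ (k * n.+1) * inv_qpoch k n.+1.
  by rewrite (inv_qpochS n k0) mulrBl mul1r subrK.
rewrite fcoefD addr_ge0 // fcoefXnM; case: ltnP => // le_m.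
by apply: IHl; lia.
Qed.

Lemma P_nonneg m1 m2 m3 l a : 0 <= (P m1 m2 m3 l)`_a.
Proof.
rewrite P_chains coef_sum; apply: sumr_ge0 => gs _.
by rewrite coefXn; case: eqP.
Qed.

Lemma pair_part_nonneg m1 m2 m3 m n :
  0 <= (P m1 m2 m3 (m%:Z + 1) \Po 'X^2)`_n.
Proof.
rewrite P_chains raddf_sum coef_sum; apply: sumr_ge0 => gs _.
by rewrite /= comp_Xn_poly -exprM coefXn; case: eqP.
Qed.

Lemma kr2_summand_nonneg m1 m2 m3 m n12 i j a b :
  0 <= kr2_summand m1 m2 m3 m n12 i j a b.
Proof.
rewrite kr2_summandE /pair_part /single_part /odd_part /even_part !monomialM fcoef_monomial.
case: eqP => _; last by rewrite mulr0 fcoef0.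
have X0 k : nonneg_series (q ^+ k).
  by move=> l; rewrite -fps_of_polyXn /= coefXn; case: eqP.
by do !apply: nonneg_seriesM => //; try exact: inv_qpoch_nonneg;
  move=> l; apply: pair_part_nonneg.
Qed.

Theorem theorem17 :
  [/\ has_formal_sum
        (fun x : nat * nat * nat * nat * nat * nat * nat =>
           let: (m1, m2, m3, m, n12, i, j) := x in
           kr2_summand m1 m2 m3 m n12 i j)
        (fun n m : nat => (kr2 n m)%:Z),
      (forall (m1 m2 m3 m n12 i j : nat) (a b : nat),
         0 <= kr2_summand m1 m2 m3 m n12 i j a b)
    & (forall (m1 m2 m3 : nat) (l : int) (a : nat),
         0 <= (P m1 m2 m3 l)`_a)].
Proof.
split; [exact: kr2_formal_sum | exact: kr2_summand_nonneg | exact: P_nonneg].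
Qed.
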